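(* Let $\beta\in B_n$ be a braid whose last proper Laurent MFW polynomial $h_M$ attains the $z$-degree $\zeta=\deg_zP_{\widehat\beta}$ of $P_{\widehat\beta}$, i.e. $\deg h_M=\zeta$. Then the degree of $h_M$ satisfies $\zeta=-\deg_vP_{\widehat\beta}$, and $(-1)^{w-n+1}h_M$ is monic. Also $x=\min\deg_vP_{\widehat\beta}\le\min\{\mu(\widehat\beta)-1-2(M-m),\ 1-\mu(\widehat\beta)\}$.
   Context: $B_n$ is the braid group on $n$ strands with standard generators $\sigma_1,\dots,\sigma_{n-1}$; $\widehat\beta$ is the oriented link obtained by the standard closure of $\beta$, and $\mu(\widehat\beta)$ is its number of components; $w=w(\beta)$ is the exponent sum (writhe) of $\beta$. The Homflypt polynomial $P_L(v,z)$ of an oriented link $L$ is determined by $P=1$ on the unknot and $P_{D_+}=vz\,P_{D_0}+v^2P_{D_-}$ for diagrams differing at one crossing (positive, smoothed, negative). For $\beta\in B_n$ one can write uniquely $P_{\widehat\beta}(v,z)=v^{w-n+1}\sum_{j=0}^{n-1}h_j(z)v^{2j}$ with $h_j\in\mathbb Z[z,z^{-1}]$ (a consequence of the Morton-Franks-Williams inequality); the $h_j$ are the Laurent MFW polynomials of $\beta$. $m$ and $M$ are the minimal and maximal $j$ with $h_j\ne0$; $h_m$ is the first proper and $h_M$ the last proper Laurent MFW polynomial. $\deg$ and $\min\deg$ denote the highest and lowest power occurring; a Laurent polynomial is monic if the coefficient of its highest power is $1$. *)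

(* Defs.v *)
From mathcomp Require Import all_boot all_order all_algebra.
From mathcomp Require Export finmap.
From mathcomp.multinomials Require Export monalg.

Set Implicit Arguments.
Unset Strict Implicit.
Unset Printing Implicit Defensive.

Import Order.TTheory GRing.Theory Num.Theory.

Local Open Scope ring_scope.

(* Laurent polynomials with integer coefficients, as finitely supported       *)
(* families of coefficients indexed by exponents: p@_(a, b) is the            *)
(* coefficient of v^a z^b, and p@_b that of z^b. The monoids that monalg can  *)
(* multiply over exclude the group int, so only the Z-module structure is     *)
(* inherited; products by monomials are given by vzmul.                       *)
Notation laurent_vz := {malg int[(int * int)%type]}.
Notation laurent_z := {malg int[int]}.

(* v^a z^b * p *)
Definition vzmul (a b : int) (p : laurent_vz) : laurent_vz :=
  \sum_(k <- msupp p) << p@_k *g (a + k.1, b + k.2) >>.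

(* The value on the empty sequence (zero polynomial) is a dummy 0. *)
Definition seq_max (s : seq int) : int := \big[Num.max/head 0 s]_(k <- s) k.
Definition seq_min (s : seq int) : int := \big[Num.min/head 0 s]_(k <- s) k.

Definition degz (p : laurent_z) : int := seq_max (msupp p).
Definition deg_v (p : laurent_vz) : int := seq_max [seq k.1 | k <- msupp p].
Definition deg_z (p : laurent_vz) : int := seq_max [seq k.2 | k <- msupp p].
Definition mindeg_v (p : laurent_vz) : int := seq_min [seq k.1 | k <- msupp p].

Definition monicz (p : laurent_z) : bool := p@_(degz p) == 1.

(* the coefficient of v^a, as a Laurent polynomial in z *)
Definition coef_v (a : int) (p : laurent_vz) : laurent_z :=
  \sum_(k <- msupp p | k.1 == a) << p@_k *g k.2 >>.

(* Oriented link diagrams in the plane in general position with respect to    *)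
(* the height function, listed from bottom to top as a sequence of elementary *)
(* pieces. The piece (i, k) acts on the strands number i, i+1 (from the left, *)
(* starting at 0) of a horizontal line:                                       *)
(*   Cup d   : a local minimum creates the strands i and i+1; the left one    *)
(*             is oriented upwards iff d, the right one iff ~~ d;             *)
(*   Cap     : a local maximum joins the strands i and i+1;                   *)
(*   Cross b : the strands i and i+1 cross; the one going from bottom left to *)
(*             top right is over iff b.                                       *)
Inductive kind := Cup of bool | Cap | Cross of bool.

Definition diagram := seq (nat * kind).

Definition kdom (k : kind) : nat := if k is Cup _ then 0 else 2.
Definition kcod (k : kind) : nat := if k is Cap then 0 else 2.

(* replaces by t the n entries of s that start at position i *)
Definition splice (T : Type) (i n : nat) (t s : seq T) : seq T :=
  take i s ++ t ++ drop (i + n) s.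

(* The orientations (true for upwards) of the strands above a piece, given    *)
(* those below it; None if the piece does not fit.                            *)
Definition step (x : nat * kind) (s : seq bool) : option (seq bool) :=
  let: (i, k) := x in
  if (i + kdom k <= size s)%N then
    let l := nth true s i in let r := nth true s i.+1 in
    match k with
    | Cup d => Some (splice i 0 [:: d; ~~ d] s)
    | Cap => if l != r then Some (splice i 2 [::] s) else None
    | Cross _ => Some (splice i 2 [:: r; l] s)
    end
  else None.

Fixpoint run (s : seq bool) (D : diagram) : option (seq bool) :=
  if D is x :: D' then obind (run^~ D') (step x s) else Some s.

Definition link_diagram (D : diagram) : bool := run [::] D == Some [::].

(* The number of components, by a sweep in which s holds, for each strand, a  *)
(* label of the arc below it; c is a fresh label.                             *)
Fixpoint count_components (c : nat) (s : seq nat) (D : diagram) : nat :=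
  if D is (i, k) :: D' then
    let x := nth 0%N s i in let y := nth 0%N s i.+1 in
    match k with
    | Cup _ => count_components c.+1 (splice i 0 [:: c; c] s) D'
    | Cap =>
        let s' := splice i 2 [::] s in
        if x == y then (count_components c s' D').+1
        else count_components c [seq if t == y then x else t | t <- s'] D'
    | Cross _ => count_components c (splice i 2 [:: y; x] s) D'
    end
  else 0%N.

Definition ncomponents (D : diagram) : nat := count_components 0 [::] D.

(* Isotopy of links: planar isotopies (m_far to m_slide_cap) and Reidemeister *)
(* moves. Orientations are carried along by the strands, and the missing      *)
(* variants (R1 at a maximum, R3 with other crossings) follow from these.     *)
Inductive diagram_move : diagram -> diagram -> Prop :=
| m_far i j k l : (i <= j)%N ->
    diagram_move [:: (i, k); (j + kcod k, l)]%N
                 [:: (j + kdom k, l); (i, k)]%N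
| m_zigzag_l i d : diagram_move [:: (i, Cup d); (i.+1, Cap)] [::]
| m_zigzag_r i d : diagram_move [:: (i.+1, Cup d); (i, Cap)] [::]
| m_slide_cup i d b :
    diagram_move [:: (i, Cup d); (i.+1, Cross b)]
                 [:: (i.+1, Cup d); (i, Cross (~~ b))]
| m_slide_cap i b :
    diagram_move [:: (i.+1, Cross b); (i, Cap)]
                 [:: (i, Cross (~~ b)); (i.+1, Cap)]
| m_R1 i d b : diagram_move [:: (i, Cup d); (i, Cross b)] [:: (i, Cup (~~ d))]
| m_R2 i b : diagram_move [:: (i, Cross b); (i, Cross (~~ b))] [::]
| m_R3 i b :
    diagram_move [:: (i, Cross b); (i.+1, Cross b); (i, Cross b)]
                 [:: (i.+1, Cross b); (i, Cross b); (i.+1, Cross b)].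

Definition unknot : diagram := [:: (0%N, Cup true); (0%N, Cap)].

(* The orientation-respecting smoothing of a crossing of the strands i, i+1   *)
(* whose orientations below the crossing are given by s.                      *)
Definition smoothing (i : nat) (s : seq bool) : diagram :=
  if nth true s i == nth true s i.+1 then [::]
  else [:: (i, Cap); (i, Cup (nth true s i.+1))].

(* P is the Homflypt polynomial. In the skein relation the crossing Cross b   *)
(* is positive iff b says whether the two strands cross in parallel.          *)
Record is_homflypt (P : diagram -> laurent_vz) : Prop := {
  homflypt_unknot : P unknot = << (0, 0) >>;
  homflypt_isotopy : forall A B l r, diagram_move l r ->
    link_diagram (A ++ l ++ B) -> link_diagram (A ++ r ++ B) ->
    P (A ++ l ++ B) = P (A ++ r ++ B);
  homflypt_skein : forall A B i s, run [::] A = Some s ->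
    let pos := nth true s i == nth true s i.+1 in
    link_diagram (A ++ (i, Cross pos) :: B) ->
    P (A ++ (i, Cross pos) :: B) =
      vzmul 1 1 (P (A ++ smoothing i s ++ B)) +
      vzmul 2 0 (P (A ++ (i, Cross (~~ pos)) :: B))
}.

(* Elements of the braid group B_n are given by words: the letter (i, true)   *)
(* is sigma_(i+1), a positive crossing, and (i, false) is its inverse.        *)
Definition braid (n : nat) := seq ('I_n.-1 * bool).

Definition writhe n (beta : braid n) : int :=
  \sum_(x <- beta) (if x.2 then 1 else -1).

(* The strands of beta go upwards and are closed up on its right. *)
Definition braid_closure n (beta : braid n) : diagram :=
  [seq (i, Cup true) | i <- iota 0 n] ++
  [seq (val x.1, Cross x.2) | x : 'I_n.-1 * bool <- beta] ++
  [seq (i, Cap) | i <- rev (iota 0 n)].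

(* The Laurent MFW polynomials h_j, from                                      *)
(*   P (braid_closure beta) = v^(w-n+1) * \sum_(j < n) h_j(z) v^(2j).         *)
Definition mfw (P : diagram -> laurent_vz) n (beta : braid n) (j : 'I_n) :
    laurent_z :=
  coef_v (writhe beta - n%:Z + 1 + (2 * j)%:Z) (P (braid_closure beta)).

Definition is_first_proper n (h : 'I_n -> laurent_z) (m : 'I_n) : Prop :=
  h m != 0 /\ forall j, h j != 0 -> (m <= j)%N.

Definition is_last_proper n (h : 'I_n -> laurent_z) (M : 'I_n) : Prop :=
  h M != 0 /\ forall j, h j != 0 -> (j <= M)%N.

(* Main.v *)
Require Import Defs.
From mathcomp Require Import all_boot all_order all_fingroup all_algebra.
From mathcomp Require Import zify ring.
Set Implicit Arguments.
Unset Strict Implicit.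
Unset Printing Implicit Defensive.
Import Order.TTheory GRing.Theory Num.Theory.
Local Open Scope ring_scope.

(** Every closed braid satisfies four properties, which together give the
    three conclusions.  Write P for its polynomial, w for the writhe, n for the
    number of strands, mu for the number of components and
    z0 = v^-1 - v.
    - The exponents of v in P are of the form w + n - 1 - 2j with j >= 0: this
      is the upper half of the Morton-Franks-Williams inequality.
    - P(v, z0) = 1, since the skein relation holds for the constant 1 when
      z = z0.
    - The exponents of z in P are at least 1 - mu.
    - The coefficient of z^(1-mu) in P is z0^(mu-1) times a Laurent polynomial in v
      that takes the value 1 at v = 1; so it is nonzero and divisible by
      (1 - v^2)^(mu-1).

    Let d = deg_v P.  By the first property d = w - n + 1 + 2M, so the
    hypothesis on h_M says that P has a term v^d z^zeta which is maximal in both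
    exponents.  When z0 = -v(1 - v^-2) is substituted for z it yields the only
    term of degree d + zeta in v, and the second property forces d + zeta = 0
    and determines the sign of its coefficient ([top_term]).  The coefficient of
    z^(1-mu) is nonzero by the fourth property, so that zeta >= 1 - mu, whence
    x <= w - n + 1 + 2m = -zeta - 2(M - m) <= mu - 1 - 2(M - m).  Its
    divisibility says that the exponents of v spread over at least 2(mu - 1)
    ([slice_span]), whence x <= -zeta - 2(mu - 1) <= 1 - mu.  The third property
    makes the fourth one pass through the skein relations in which the
    smoothing joins two components.

    The four properties ([skein_shape]) are proved by induction on n without
    leaving the closed braids ([closure_shapeP]), as for the Ocneanu trace on
    Hecke algebras.  They pass from any two terms of a skein relation to one of
    the outer terms ([skein_shape_step]).  By skein relations and braid
    relations any word in n strands is reduced to words in which the last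
    generator occurs at most once ([skein_reduction]).  If it occurs once, it is
    removed by conjugation and a Markov move, and if it does not occur, the last
    strand is a split unknot, which is compared with the two stabilizations by
    one more skein relation ([skein_shape_split]).  The Markov moves are derived
    from moves of diagrams in [word_closure_conj] and [word_closure_stab].  The
    number of components is the number of cycles of the permutation of the braid
    ([ncomponents_closure]). *)

(** * Local action of the elementary pieces *)

Arguments step : simpl never.

Lemma run_cat s A B : run s (A ++ B) = obind (run^~ B) (run s A).
Proof. by elim: A s => [|x A IH] s //=; case: (step x s) => //= t; apply: IH. Qed.

Lemma split_at (T : Type) i k (s : seq T) : (i + k <= size s)%N ->
  exists a x b, [/\ s = a ++ x ++ b, size a = i & size x = k].
Proof.
move=> h; exists (take i s), (take k (drop i s)), (drop k (drop i s)).
rewrite !cat_take_drop !size_take_min size_drop; split=> //; lia.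
Qed.

Lemma split_at1 (T : Type) i (s : seq T) : (i < size s)%N ->
  exists a x c, s = a ++ x :: c /\ size a = i.
Proof.
rewrite -addn1 => /split_at [a [x [c [-> ha]]]].
by case: x => [|x []] // _; exists a, x, c.
Qed.

Lemma split_at2 (T : Type) i (s : seq T) : (i.+1 < size s)%N ->
  exists a x y c, s = a ++ [:: x, y & c] /\ size a = i.
Proof.
rewrite -addn2 => /split_at [a [x [c [-> ha]]]].
by case: x => [|x [|y []]] // _; exists a, x, y, c.
Qed.

Lemma split_at3 (T : Type) i (s : seq T) : (i.+2 < size s)%N ->
  exists a x y z c, s = a ++ [:: x, y, z & c] /\ size a = i.
Proof.
rewrite -addn3 => /split_at [a [x [c [-> ha]]]].
by case: x => [|x [|y [|z []]]] // _; exists a, x, y, z, c.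
Qed.

(** Isolating the strands that a piece meets turns the commutation of distant
    pieces into a computation with concatenations. *)
Definition act (k : kind) (x : seq bool) : option (seq bool) :=
  match k, x with
  | Cup d, [::] => Some [:: d; ~~ d]
  | Cap, [:: l; r] => if l != r then Some [::] else None
  | Cross _, [:: l; r] => Some [:: r; l]
  | _, _ => None
  end.

Lemma step_act a x b k : size x = kdom k ->
  step (size a, k) (a ++ x ++ b) = omap (fun y => a ++ y ++ b) (act k x).
Proof.
move=> hx; rewrite /step !size_cat hx leq_add2l leq_addr /splice.
rewrite take_size_cat // !nth_cat ltnn subnn.
have -> : ((size a).+1 < size a)%N = false by lia.
rewrite subSnn; case: k hx => [d||c] /=.
- by case: x => // _; rewrite addn0 drop_size_cat.
- case: x => [|l [|r []]] // _ /=.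
  by case: (l != r) => //=; rewrite addnC -drop_drop drop_size_cat //= drop0.
- case: x => [|l [|r []]] // _ /=.
  by rewrite addnC -drop_drop drop_size_cat //= drop0.
Qed.

Lemma step_short i k s : (size s < i + kdom k)%N -> step (i, k) s = None.
Proof. by rewrite /step ltnNge => /negbTE ->. Qed.

Lemma size_act k x y : act k x = Some y -> size y = kcod k.
Proof.
case: k => [d||c]; case: x => [|l [|r []]] //=.
- by case=> <-.
- by case: ifP => // _ [<-].
- by case=> <-.
Qed.

Lemma step_act_at i a x y b k : size a = i -> act k x = Some y ->
  step (i, k) (a ++ x ++ b) = Some (a ++ y ++ b).
Proof.
move=> <- h; rewrite step_act ?h //.
by case: k h => [d||c]; case: x => [|l [|r []]].
Qed.

Lemma size_step i k s t :
  step (i, k) s = Some t -> (size t + kdom k = size s + kcod k)%N.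
Proof.
case: (leqP (i + kdom k) (size s)) => [/split_at|/step_short -> //].
case=> a [x [b [-> <- hx]]]; rewrite step_act //; case h: (act k x) => [y|] //= [<-].
by rewrite !size_cat hx (size_act h); lia.
Qed.

(** Distant pieces act on disjoint segments of the state; the positions of the
    upper piece differ by the strands that the other one creates or removes. *)
Lemma run_far i j k l s : (i <= j)%N ->
  run s [:: (i, k); (j + kcod k, l)]%N = run s [:: (j + kdom k, l); (i, k)]%N.
Proof.
move=> le_ij; case: (leqP (j + kdom k + kdom l) (size s)) => hs; last first.
  rewrite /= (step_short hs) /=.
  case h: (step (i, k) s) => [t|] //=.
  by rewrite step_short //; move: hs (size_step h); lia.
have [a [x' [b [def_s ha hx']]]] := split_at hs.
have /split_at [a1 [x [c [def_a ha1 hx]]]] : (i + kdom k <= size a)%N by lia.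
have rhs : step (j + kdom k, l)%N s = omap (fun y => a ++ y ++ b) (act l x').
  by rewrite def_s -ha step_act.
have lhs : step (i, k) s = omap (fun y => a1 ++ y ++ c ++ x' ++ b) (act k x).
  by rewrite def_s def_a -!catA -ha1 step_act.
rewrite /= rhs lhs; case hy: (act k x) => [y|] /=; last first.
  by case: (act l x') => [y'|] //=; rewrite def_a -!catA -ha1 step_act // hy.
have -> : (j + kcod k)%N = size (a1 ++ y ++ c).
  by rewrite !size_cat (size_act hy) ha1; move: ha; rewrite def_a !size_cat; lia.
have -> : a1 ++ y ++ c ++ x' ++ b = (a1 ++ y ++ c) ++ x' ++ b by rewrite -!catA.
rewrite step_act //; case: (act l x') => [y'|] //=.
by rewrite def_a -!catA -ha1 step_act // hy.
Qed.

Lemma run_slide_cup i d b s :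
  run s [:: (i, Cup d); (i.+1, Cross b)] =
  run s [:: (i.+1, Cup d); (i, Cross (~~ b))].
Proof.
case: (leqP i.+1 (size s)) => hs; last first.
  rewrite /= [in RHS]step_short /=; last lia.
  case h: (step _ s) => [t|] //=; rewrite step_short //=.
  by have := size_step h; rewrite /=; lia.
have [a [x [c [-> <-]]]] := split_at1 hs.
rewrite /= (@step_act a [::]) //= -addn1 -(size_cat a [:: x]).
have -> : a ++ x :: c = (a ++ [:: x]) ++ [::] ++ c by rewrite -catA.
rewrite (@step_act (a ++ [:: x]) [::]) //=.
have -> : a ++ [:: d, ~~ d & x :: c] = (a ++ [:: d]) ++ [:: ~~ d; x] ++ c.
  by rewrite -catA.
rewrite size_cat -(size_cat a [:: d]) step_act //= -!catA.
by rewrite (@step_act a [:: x; d]).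
Qed.

Lemma run_slide_cap i b s :
  run s [:: (i.+1, Cross b); (i, Cap)] =
  run s [:: (i, Cross (~~ b)); (i.+1, Cap)].
Proof.
case: (leqP i.+3 (size s)) => hs; last first.
  rewrite /= step_short /=; last lia.
  case: (leqP i.+2 (size s)) => hs2; last first.
    by rewrite step_short //=; lia.
  have [a [x [y [c [def_s ha]]]]] := split_at2 hs2.
  case: c def_s => [|z c] def_s; last first.
    by move: hs; rewrite def_s !size_cat /=; lia.
  by rewrite def_s -ha (@step_act a [:: x; y]) //= step_short // size_cat /=; lia.
have [a [x [y [z [c [-> <-]]]]]] := split_at3 hs.
rewrite /= -addn1 -(size_cat a [:: x]).
have -> : a ++ [:: x, y, z & c] = (a ++ [:: x]) ++ [:: y; z] ++ c.
  by rewrite -catA.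
rewrite step_act //= -!catA (@step_act a [:: x; z]) //=.
rewrite (@step_act a [:: x; y]) //=.
rewrite size_cat -(size_cat a [:: y]).
have -> : a ++ [:: y, x, z & c] = (a ++ [:: y]) ++ [:: x; z] ++ c.
  by rewrite -catA.
by rewrite step_act //=; case: (x != z) => //=; rewrite -catA.
Qed.

Lemma run_R3 i b s :
  run s [:: (i, Cross b); (i.+1, Cross b); (i, Cross b)] =
  run s [:: (i.+1, Cross b); (i, Cross b); (i.+1, Cross b)].
Proof.
case: (leqP i.+3 (size s)) => hs; last first.
  rewrite /= [in RHS]step_short /=; last lia.
  case: (leqP i.+2 (size s)) => hs2; last first.
    by rewrite step_short //=; lia.
  have [a [x [y [c [def_s ha]]]]] := split_at2 hs2.
  case: c def_s => [|z c] def_s; last first.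
    by move: hs; rewrite def_s !size_cat /=; lia.
  by rewrite def_s -ha (@step_act a [:: x; y]) //= step_short // size_cat /=; lia.
have [a [x [y [z [c [-> <-]]]]]] := split_at3 hs.
have E u v w : a ++ [:: u, v, w & c] = (a ++ [:: u]) ++ [:: v; w] ++ c.
  by rewrite -catA.
have S1 u v w : step (size a, Cross b) (a ++ [:: u, v, w & c]) =
    Some (a ++ [:: v, u, w & c]) by rewrite (@step_act a [:: u; v]).
have S2 u v w : step ((size a).+1, Cross b) (a ++ [:: u, v, w & c]) =
    Some (a ++ [:: u, w, v & c]).
  by rewrite E -addn1 -(size_cat a [:: u]) step_act //= -catA.
by rewrite /= !(S1, S2) /= !(S1, S2) /= !(S1, S2).
Qed.

(** Zigzags and the second Reidemeister move are the moves whose two sides do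
    not fit the same states: the empty side fits everywhere.  Hence only an
    implication. *)
Lemma run_move l r s t : diagram_move l r -> run s l = Some t -> run s r = Some t.
Proof.
have R2 i b u : run s [:: (i, Cross b); (i, Cross (~~ b))] = Some u -> s = u.
  case: (leqP i.+2 (size s)) => [/split_at2|hs]; last first.
    by rewrite /= step_short //=; lia.
  case=> a [x [y [c [-> <-]]]].
  by rewrite /= (@step_act a [:: x; y]) //= (@step_act a [:: y; x]) //= => -[].
case=> {l r}.
- by move=> i j k l /run_far ->.
- move=> i d; case: (leqP i.+1 (size s)) => hs /=.
    have [a [x [c [-> <-]]]] := split_at1 hs.
    rewrite /= (@step_act a [::]) //=.
    have -> : a ++ [:: d, ~~ d & x :: c] = (a ++ [:: d]) ++ [:: ~~ d; x] ++ c.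
      by rewrite -catA.
    rewrite -addn1 -(size_cat a [:: d]) step_act //=.
    by case: (~~ d =P x) => //= /eqP; case: d x => [] [] //= _; rewrite -catA.
  case h: (step _ s) => [u|] //=; rewrite step_short //=.
  by have := size_step h; rewrite /=; lia.
- move=> i d; case: (leqP i.+1 (size s)) => hs /=; last first.
    by rewrite step_short //=; lia.
  have [a [x [c [-> <-]]]] := split_at1 hs.
  rewrite -addn1 -(size_cat a [:: x]).
  have -> : a ++ [:: x] ++ c = (a ++ [:: x]) ++ [::] ++ c by rewrite -catA.
  rewrite (@step_act _ [::]) //= -catA /= (@step_act a [:: x; d]) //=.
  by case: d x => [] [] //=; rewrite -catA.
- by move=> i d b; rewrite run_slide_cup.
- by move=> i b; rewrite run_slide_cap.
- move=> i d b; case: (leqP (i + 0) (size s)) => hs; last by rewrite /= step_short.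
  have [a [x [c [-> <- hx]]]] := split_at hs; case: x hx => // _.
  rewrite /= !(@step_act a [::]) //= (@step_act a [:: d; ~~ d]) //=.
  by rewrite negbK.
- by move=> i b /R2 ->.
- by move=> i b; rewrite run_R3.
Qed.

(** * Replacing pieces of diagrams; Markov moves *)

Section Replacement.
Context (P : diagram -> laurent_vz) (hP : is_homflypt P).

(** A local isotopy, read from l to r.  It is oriented because r may fit states
    that l does not fit.  Quantifying over all states that l fits makes it
    compatible with concatenation, so that isotopies are assembled without
    computing the states between the pieces. *)
Definition replaceable (l r : diagram) : Prop := forall s t,
  run s l = Some t -> run s r = Some t /\
  forall A B, run [::] A = Some s -> run t B = Some [::] ->
    P (A ++ l ++ B) = P (A ++ r ++ B).

Lemma replaceable_refl l : replaceable l l.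
Proof. by move=> s t ->. Qed.

Lemma replaceable_trans m l r :
  replaceable l m -> replaceable m r -> replaceable l r.
Proof.
move=> lm mr s t /lm [/mr [-> h1] h2]; split=> // A B hA hB.
by rewrite h2 ?h1.
Qed.

Lemma replaceable_cat l l' r r' :
  replaceable l r -> replaceable l' r' -> replaceable (l ++ l') (r ++ r').
Proof.
move=> h h' s t; rewrite !run_cat; case hl: (run s l) => [u|] //= hl'.
have [hr e] := h _ _ hl; have [hr' e'] := h' _ _ hl'.
rewrite hr; split=> // A B hA hB.
rewrite -!catA e // ?run_cat ?hl' //.
by rewrite !(catA A r) e' // run_cat hA.
Qed.

Lemma replaceable_catl A l r : replaceable l r -> replaceable (A ++ l) (A ++ r).
Proof. exact/replaceable_cat/replaceable_refl. Qed.

Lemma replaceable_catr B l r : replaceable l r -> replaceable (l ++ B) (r ++ B).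
Proof. by move=> h; apply: replaceable_cat h (@replaceable_refl B). Qed.

Lemma replaceable_link l r : replaceable l r -> link_diagram l -> P l = P r.
Proof.
move=> h /eqP /h [_ e].
by have := e [::] [::] erefl erefl; rewrite !cats0.
Qed.

Lemma replaceable_move l r : diagram_move l r -> replaceable l r.
Proof.
move=> h s t hl; have hr := run_move h hl; split=> // A B hA hB.
by apply: (homflypt_isotopy hP h);
  rewrite /link_diagram run_cat hA /= run_cat ?hl ?hr /= hB.
Qed.

Lemma replaceable_move_sym l r : diagram_move l r ->
  (forall s, run s l = run s r) -> replaceable r l.
Proof.
move=> h e s t hr; have hl : run s l = Some t by rewrite e.
split=> // A B hA hB; apply/esym.
by have [_] := replaceable_move h hl; apply.
Qed.

Lemma replaceable_far i j k l : (i <= j)%N ->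
  replaceable [:: (i, k); (j + kcod k, l)]%N [:: (j + kdom k, l); (i, k)]%N.
Proof. by move=> h; apply/replaceable_move/m_far. Qed.

Lemma replaceable_far_sym i j k l : (i <= j)%N ->
  replaceable [:: (j + kdom k, l); (i, k)]%N [:: (i, k); (j + kcod k, l)]%N.
Proof.
move=> h; apply: replaceable_move_sym; first exact: m_far.
by move=> s; apply: run_far.
Qed.

Lemma replaceable_far_cross i j e f : (i.+1 < j)%N || (j.+1 < i)%N ->
  replaceable [:: (i, Cross e); (j, Cross f)] [:: (j, Cross f); (i, Cross e)].
Proof.
case/orP=> h.
  have := @replaceable_far i (j - 2) (Cross e) (Cross f) ltac:(lia).
  by rewrite /= subnK //; lia.
have := @replaceable_far_sym j (i - 2) (Cross f) (Cross e) ltac:(lia).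
by rewrite /= subnK //; lia.
Qed.

Definition word := seq (nat * bool).
Definition cups n : diagram := [seq (i, Cup true) | i <- iota 0 n].
Definition caps n : diagram := [seq (i, Cap) | i <- rev (iota 0 n)].
Definition crossings (w : word) : diagram := [seq (x.1, Cross x.2) | x <- w].
Definition word_closure n w : diagram := cups n ++ crossings w ++ caps n.

Lemma cupsS n : cups n.+1 = cups n ++ [:: (n, Cup true)].
Proof. by rewrite /cups -addn1 iotaD map_cat. Qed.

Lemma capsS n : caps n.+1 = (n, Cap) :: caps n.
Proof. by rewrite /caps -addn1 iotaD rev_cat. Qed.

Definition is_word n (w : word) := all (fun x => x.1.+1 < n)%N w.

(** The state of a closed braid between its cups and its caps: n strands upwards
    and, to their right, the n returning strands. *)
Definition level n : seq bool := nseq n true ++ nseq n false.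

Lemma levelS n : level n.+1 = nseq n true ++ [:: true; false] ++ nseq n false.
Proof.
by rewrite /level -addn1 nseqD -catA /= addn1.
Qed.

Lemma run_cups n : run [::] (cups n) = Some (level n).
Proof.
elim: n => [|n IH] //; rewrite cupsS run_cat IH /= levelS.
by rewrite (@step_act_at _ _ [::] [:: true; false]) // size_nseq.
Qed.

Lemma run_caps n : run (level n) (caps n) = Some [::].
Proof.
elim: n => [|n IH] //; rewrite capsS /= levelS.
by rewrite (@step_act_at _ _ [:: true; false] [::]) // size_nseq.
Qed.

Lemma run_crossings n w : is_word n w -> run (level n) (crossings w) = Some (level n).
Proof.
elim: w => [|[i e] w IH] //= /andP [hi /IH].
suff -> : step (i, Cross e) (level n) = Some (level n) by [].
have E : level n = nseq i true ++ [:: true; true] ++ nseq (n - i.+2) true ++ nseq n false.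
  rewrite /level catA -(nseqD i 2) catA -nseqD; congr (nseq _ _ ++ _); lia.
by rewrite E (step_act_at _ (y := [:: true; true])) // size_nseq.
Qed.

Lemma link_closure n w : is_word n w -> link_diagram (word_closure n w).
Proof.
by move=> h; rewrite /link_diagram run_cat run_cups /= run_cat run_crossings //= run_caps.
Qed.

(** Past two nested minima the crossing is carried by one slide along each of them;
    a slide exchanges over and under, so that the sign is restored.  The further
    minima inside only renumber the strands. *)
Lemma slide_cups i n e : (i.+1 < n)%N ->
  replaceable (cups n ++ [:: (i, Cross e)]) (cups n ++ [:: (n.*2 - i.+2, Cross e)%N]).
Proof.
elim: n => // n IH hn; case: (leqP n i.+1) => hi.
  have -> : n = i.+1 by lia.
  rewrite (_ : (i.+2.*2 - i.+2 = i.+2)%N); last lia.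
  rewrite 2!cupsS -!catA; apply: replaceable_catl => /=.
  apply: (@replaceable_trans [:: (i, Cup true); (i, Cup true); (i.+1, Cross (~~ e))]).
    apply: (@replaceable_catl [:: (i, Cup true)]).
    apply: replaceable_move_sym => [|s]; last exact: run_slide_cup.
    by rewrite -{2}[e]negbK; apply: m_slide_cup.
  apply: (@replaceable_trans [:: (i, Cup true); (i.+2, Cup true); (i.+1, Cross (~~ e))]).
    apply: (@replaceable_catr [:: (i.+1, Cross (~~ e))] [:: (i, Cup true); (i, Cup true)]
      [:: (i, Cup true); (i.+2, Cup true)]).
    have := @replaceable_far_sym i i (Cup true) (Cup true) (leqnn i).
    by rewrite /= addn0 addn2.
  apply: (@replaceable_catl [:: (i, Cup true)]).
  apply: replaceable_move_sym => [|s]; last exact: run_slide_cup.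
  exact: m_slide_cup.
rewrite cupsS -!catA.
apply: (@replaceable_trans (cups n ++ [:: (i, Cross e)] ++ [:: (n, Cup true)])).
  apply: replaceable_catl => /=.
  have := @replaceable_far_sym i (n - 2) (Cross e) (Cup true) ltac:(lia).
  by rewrite /= subnK //; lia.
rewrite catA; apply: (@replaceable_trans
  ((cups n ++ [:: (n.*2 - i.+2, Cross e)%N]) ++ [:: (n, Cup true)])).
  exact/replaceable_catr/IH.
rewrite -catA; apply: replaceable_catl => /=.
have := @replaceable_far_sym n (n.*2 - i.+2) (Cup true) (Cross e) ltac:(lia).
rewrite /= addn0 (_ : (n.*2 - i.+2 + 2 = n.+1.*2 - i.+2)%N) //; lia.
Qed.

(** The mirror image of [slide_cups] at the maxima, read backwards: the crossing
    returns to the left. *)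
Lemma slide_caps i n e : (i.+1 < n)%N ->
  replaceable ((n.*2 - i.+2, Cross e)%N :: caps n) ((i, Cross e) :: caps n).
Proof.
elim: n => // n IH hn; case: (leqP n i.+1) => hi.
  have -> : n = i.+1 by lia.
  rewrite (_ : (i.+2.*2 - i.+2 = i.+2)%N); last lia.
  rewrite 2!capsS.
  apply: (@replaceable_catr (caps i) [:: (i.+2, Cross e); (i.+1, Cap); (i, Cap)]
    [:: (i, Cross e); (i.+1, Cap); (i, Cap)]).
  apply: (@replaceable_trans [:: (i.+1, Cross (~~ e)); (i.+2, Cap); (i, Cap)]).
    apply: (@replaceable_catr [:: (i, Cap)] [:: (i.+2, Cross e); (i.+1, Cap)]
      [:: (i.+1, Cross (~~ e)); (i.+2, Cap)]).
    exact/replaceable_move/m_slide_cap.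
  apply: (@replaceable_trans [:: (i.+1, Cross (~~ e)); (i, Cap); (i, Cap)]).
    apply: (@replaceable_catl [:: (i.+1, Cross (~~ e))]).
    by have := @replaceable_far_sym i i Cap Cap (leqnn i); rewrite /= addn0 addn2.
  apply: (@replaceable_catr [:: (i, Cap)] [:: (i.+1, Cross (~~ e)); (i, Cap)]
      [:: (i, Cross e); (i.+1, Cap)]).
  by rewrite -{2}[e]negbK; apply/replaceable_move/m_slide_cap.
rewrite capsS.
apply: (@replaceable_trans ([:: (n, Cap); (n.*2 - i.+2, Cross e)%N] ++ caps n)).
  apply: (@replaceable_catr (caps n) [:: _; _]).
  have := @replaceable_far_sym n (n.*2 - i.+2) Cap (Cross e) ltac:(lia).
  rewrite /= addn0 (_ : (n.*2 - i.+2 + 2 = n.+1.*2 - i.+2)%N) //; lia.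
apply: (@replaceable_trans ([:: (n, Cap)] ++ (i, Cross e) :: caps n)).
  exact/(@replaceable_catl [:: (n, Cap)])/IH.
apply: (@replaceable_catr (caps n) [:: _; _] [:: _; _]).
have := @replaceable_far_sym i (n - 2) (Cross e) Cap ltac:(lia).
by rewrite /= subnK //; lia.
Qed.

Lemma replaceable_far_word n x e w : is_word n w -> (n <= x)%N ->
  replaceable ((x, Cross e) :: crossings w) (crossings w ++ [:: (x, Cross e)]).
Proof.
move=> hw hx; elim: w hw => [|[i f] w IH] /=; first by move=> _; apply: replaceable_refl.
case/andP=> hi /IH {}IH.
apply: (@replaceable_trans [:: (i, Cross f), (x, Cross e) & crossings w]).
  apply: (@replaceable_catr (crossings w) [:: _; _] [:: _; _]).
  by apply: replaceable_far_cross; apply/orP; right; lia.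
exact: (@replaceable_catl [:: (i, Cross f)]).
Qed.

Lemma replaceable_cup_word n w : is_word n w ->
  replaceable ((n, Cup true) :: crossings w) (crossings w ++ [:: (n, Cup true)]).
Proof.
elim: w => [|[i e] w IH] /=; first by move=> _; apply: replaceable_refl.
case/andP=> hi /IH {}IH.
apply: (@replaceable_trans [:: (i, Cross e), (n, Cup true) & crossings w]).
  apply: (@replaceable_catr (crossings w) [:: _; _] [:: _; _]).
  have := @replaceable_far_sym i (n - 2) (Cross e) (Cup true) ltac:(lia).
  by rewrite /= subnK //; lia.
exact: (@replaceable_catl [:: (i, Cross e)]).
Qed.

Lemma crossings_cat w w' : crossings (w ++ w') = crossings w ++ crossings w'.
Proof. exact: map_cat. Qed.

Lemma is_word_cat n w w' : is_word n (w ++ w') = is_word n w && is_word n w'.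
Proof. exact: all_cat. Qed.

(** The lowest crossing travels around the closure: past the minima to the
    returning strands, up along them, and past the maxima to the top of the
    braid. *)
Lemma word_closure_rot1 n x w : is_word n (x :: w) ->
  P (word_closure n (x :: w)) = P (word_closure n (rcons w x)).
Proof.
move=> hw; apply: replaceable_link (link_closure hw).
case: x hw => i e /= /andP [/= hi hw]; rewrite /word_closure -cats1 crossings_cat /=.
apply: (@replaceable_trans
   ((cups n ++ [:: (n.*2 - i.+2, Cross e)%N]) ++ crossings w ++ caps n)).
  rewrite -[_ :: _ ++ _]cat1s catA.
  exact/replaceable_catr/slide_cups.
rewrite -!catA; apply: replaceable_catl.
apply: (@replaceable_trans
   ((crossings w ++ [:: (n.*2 - i.+2, Cross e)%N]) ++ caps n)).
  apply: (@replaceable_catr (caps n) (_ :: crossings w)).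
  by apply: (@replaceable_far_word n) => //; lia.
rewrite -!catA; apply: replaceable_catl; exact: slide_caps.
Qed.

Lemma word_closure_conj n a b : is_word n (a ++ b) ->
  P (word_closure n (a ++ b)) = P (word_closure n (b ++ a)).
Proof.
elim: a b => [|x a IH] b; first by rewrite cats0.
move=> h; rewrite word_closure_rot1 // -cats1 -catA IH; last first.
    by move: h; rewrite /is_word /= !all_cat /= andbT => /and3P [-> -> ->].
by rewrite -catA.
Qed.

Lemma word_closure_R2 n a i e b : is_word n (a ++ [:: (i, e); (i, ~~ e)] ++ b) ->
  P (word_closure n (a ++ [:: (i, e); (i, ~~ e)] ++ b)) = P (word_closure n (a ++ b)).
Proof.
move=> h; apply: replaceable_link (link_closure h).
rewrite /word_closure !crossings_cat -!catA; do 2! apply: replaceable_catl.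
exact/(@replaceable_catr _ [:: _; _] [::])/replaceable_move/m_R2.
Qed.

Lemma word_closure_R3 n a i e b :
  is_word n (a ++ [:: (i.+1, e); (i, e); (i.+1, e)] ++ b) ->
  P (word_closure n (a ++ [:: (i.+1, e); (i, e); (i.+1, e)] ++ b)) =
  P (word_closure n (a ++ [:: (i, e); (i.+1, e); (i, e)] ++ b)).
Proof.
move=> h; apply: replaceable_link (link_closure h).
rewrite /word_closure !crossings_cat -!catA; do 2! apply: replaceable_catl.
apply: (@replaceable_catr _ [:: _; _; _] [:: _; _; _]).
apply: replaceable_move_sym; first exact: m_R3.
by move=> s; apply: run_R3.
Qed.

Lemma word_closure_far n a i j e f b : (i.+1 < j)%N || (j.+1 < i)%N ->
  is_word n (a ++ [:: (i, e); (j, f)] ++ b) ->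
  P (word_closure n (a ++ [:: (i, e); (j, f)] ++ b)) =
  P (word_closure n (a ++ [:: (j, f); (i, e)] ++ b)).
Proof.
move=> hij h; apply: replaceable_link (link_closure h).
rewrite /word_closure !crossings_cat -!catA; do 2! apply: replaceable_catl.
exact/(@replaceable_catr _ [:: _; _] [:: _; _])/replaceable_far_cross.
Qed.

(** The innermost closing arc meets only the last crossing.  Sliding this crossing
    past the maximum of the arc turns it into a kink at the minimum; the first
    Reidemeister move removes the kink and leaves a zigzag. *)
Lemma word_closure_stab n w e : is_word n.+1 w ->
  P (word_closure n.+2 (w ++ [:: (n, e)])) = P (word_closure n.+1 w).
Proof.
move=> hw; apply: replaceable_link; last first.
  apply: link_closure; rewrite is_word_cat /= !ltnS leqnn !andbT.
  by apply: sub_all hw => x /=; lia.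
rewrite /word_closure cupsS capsS crossings_cat -!catA; apply: replaceable_catl.
apply: (@replaceable_trans
  (crossings w ++ [:: (n.+1, Cup true); (n, Cross e); (n.+1, Cap)] ++ caps n.+1)).
  have := @replaceable_catr ([:: (n, Cross e); (n.+1, Cap)] ++ caps n.+1) _ _
            (replaceable_cup_word hw).
  by rewrite -catA.
apply: replaceable_catl; apply: (@replaceable_catr _ [:: _; _; _] [::]).
apply: (@replaceable_trans [:: (n.+1, Cup true); (n.+1, Cross (~~ e)); (n, Cap)]).
  apply: (@replaceable_catl [:: (n.+1, Cup true)]).
  apply: replaceable_move_sym; last exact: run_slide_cap.
  by rewrite -{2}[e]negbK; apply: m_slide_cap.
apply: (@replaceable_trans [:: (n.+1, Cup false); (n, Cap)]).
  apply: (@replaceable_catr [:: (n, Cap)] [:: _; _] [:: _]).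
  exact/replaceable_move/(m_R1 _ true).
exact/replaceable_move/m_zigzag_r.
Qed.

(** The strands of a closed braid are parallel at each crossing, so that smoothing
    deletes the letter. *)
Lemma word_closure_skein n a i b : is_word n (a ++ (i, true) :: b) ->
  P (word_closure n (a ++ (i, true) :: b)) =
  vzmul 1 1 (P (word_closure n (a ++ b))) +
  vzmul 2 0 (P (word_closure n (a ++ (i, false) :: b))).
Proof.
move=> h; have hl := link_closure h; move: h hl.
rewrite is_word_cat /= => /and3P [ha hi _].
have hA : run [::] (cups n ++ crossings a) = Some (level n).
  by rewrite run_cat run_cups /= run_crossings.
have hT j : (j < n)%N -> nth true (level n) j = true.
  by move=> hj; rewrite nth_cat size_nseq hj nth_nseq hj.
have := homflypt_skein hP (B := crossings b ++ caps n) (i := i) hA.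
rewrite /smoothing !hT //=; last lia.
by rewrite /word_closure !crossings_cat /= -!catA.
Qed.

End Replacement.

(** * Skein reduction of braid words *)

(** The predicates that can be studied in the Hecke algebra: by [skein_flip] they
    pass from two terms of a skein relation to the third one, and they respect
    the braid relations. *)
Record skein_closed (S : word -> Prop) : Prop := {
  skein_flip : forall a i e b,
    S (a ++ b) -> S (a ++ (i, ~~ e) :: b) -> S (a ++ (i, e) :: b);
  skein_R2 : forall a i e b, S (a ++ b) -> S (a ++ [:: (i, e); (i, ~~ e)] ++ b);
  skein_R3 : forall a i e b,
    S (a ++ [:: (i, e); (i.+1, e); (i, e)] ++ b) ->
    S (a ++ [:: (i.+1, e); (i, e); (i.+1, e)] ++ b);
  skein_far : forall a i j e f b, (i.+1 < j)%N || (j.+1 < i)%N ->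
    S (a ++ [:: (j, f); (i, e)] ++ b) -> S (a ++ [:: (i, e); (j, f)] ++ b)
}.

(** Allows a reduction to be applied to an inner part of a word. *)
Lemma skein_closed_ctx u v S :
  skein_closed S -> skein_closed (fun w => S (u ++ w ++ v)).
Proof.
have E a b : u ++ (a ++ b) ++ v = (u ++ a) ++ b ++ v by rewrite -!catA.
case=> h1 h2 h3 h4.
split=> [a i e b|a i e b|a i e b|a i j e f b hij]; rewrite !(E a).
- exact: h1.
- exact: h2.
- exact: h3.
- exact: h4.
Qed.

Definition letters_lt k (w : word) := all (fun x => x.1 < k)%N w.
Definition occurrences k (w : word) := count (fun x => x.1 == k) w.

Arguments occurrences : simpl never.

Lemma occurrences_cons k x w :
  occurrences k (x :: w) = ((x.1 == k) + occurrences k w)%N.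
Proof. by []. Qed.

Lemma occurrences_cat k u v :
  occurrences k (u ++ v) = (occurrences k u + occurrences k v)%N.
Proof. exact: count_cat. Qed.

Lemma letters_lt_cat k u v : letters_lt k (u ++ v) = letters_lt k u && letters_lt k v.
Proof. exact: all_cat. Qed.

Lemma letters_ltS k w :
  letters_lt k w = letters_lt k.+1 w && (occurrences k w == 0)%N.
Proof.
elim: w => //= x w ->.
rewrite occurrences_cons addn_eq0 eqb0; case: (ltngtP x.1 k) => h /=;
  rewrite ?andbF ?andbT ?andFb //; case: (ltnP x.1 k.+1) => //; lia.
Qed.

Lemma first_occurrence k w : letters_lt k.+1 w -> (0 < occurrences k w)%N ->
  exists u e v, [/\ w = u ++ (k, e) :: v, letters_lt k u, letters_lt k.+1 v
                  & occurrences k w = (occurrences k v).+1].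
Proof.
elim: w => // -[i e] w IH /andP [/= hi hw]; rewrite occurrences_cons /=.
case: (eqVneq i k) => [->|hik] /=; first by exists [::], e, w.
rewrite add0n => /(IH hw) [u [f [v [-> hu hv ->]]]].
by exists ((i, e) :: u), f, v; split=> //=; rewrite hu andbT; lia.
Qed.

Lemma bool_neq (a b : bool) : a != b -> a = ~~ b.
Proof. by case: a b => [] []. Qed.

Section Reduction.
Context (S : word -> Prop) (hS : skein_closed S).

Lemma skein_commute_left k e u a b : letters_lt k u ->
  S (a ++ u ++ (k.+1, e) :: b) -> S (a ++ (k.+1, e) :: u ++ b).
Proof.
elim: u a => [|[i f] u IH] a //= /andP [/= hi hu] h.
apply: (skein_far hS (a := a) (b := u ++ b)); first by apply/orP; right; lia.
by have := IH (a ++ [:: (i, f)]); rewrite -!catA; apply.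
Qed.

Lemma skein_commute_right k e u a b : letters_lt k u ->
  S (a ++ (k.+1, e) :: u ++ b) -> S (a ++ u ++ (k.+1, e) :: b).
Proof.
elim: u a => [|[i f] u IH] a //= /andP [/= hi hu] h.
have := IH (a ++ [:: (i, f)]) hu; rewrite -!catA; apply=> /=.
by apply: (skein_far hS (a := a) (b := u ++ b)) => //; apply/orP; left; lia.
Qed.

(** The quadratic relation of the Hecke algebra: s^2 is a combination of 1 and s. *)
Lemma skein_pair a i e f b : S (a ++ b) -> S (a ++ (i, e) :: b) ->
  S (a ++ [:: (i, e); (i, f)] ++ b).
Proof.
move=> h0 h1; case: (eqVneq f e) => [->|/bool_neq ->]; last exact: skein_R2.
have := skein_flip hS (a := a ++ [:: (i, e)]) (i := i) (e := e) (b := b).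
rewrite -!catA; apply=> //; exact: skein_R2.
Qed.

(** Up to shorter words the skein relations change signs until the three letters
    have the same sign; then the braid relation sts = tst leaves a single s. *)
Lemma skein_triple a i e g f b :
  S (a ++ b) -> S (a ++ (i.+1, e) :: b) ->
  S (a ++ [:: (i.+1, e); (i, e)] ++ b) ->
  S (a ++ [:: (i, e); (i.+1, e); (i, e)] ++ b) ->
  S (a ++ [:: (i.+1, e); (i, g); (i.+1, f)] ++ b).
Proof.
move=> h0 h1 h2 h3.
have hf : S (a ++ [:: (i.+1, e); (i, e); (i.+1, f)] ++ b).
  case: (eqVneq e f) => [<-|/bool_neq def_e]; first exact: skein_R3.
  have := skein_flip hS (a := a ++ [:: (i.+1, e); (i, e)]) (i := i.+1) (e := f) (b := b).
  rewrite -!catA -def_e; apply=> //; exact: skein_R3.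
case: (eqVneq e g) => [<- //|/bool_neq def_e].
have := skein_flip hS (a := a ++ [:: (i.+1, e)]) (i := i) (e := g) (b := (i.+1, f) :: b).
rewrite -!catA -def_e; apply=> //; exact: skein_pair.
Qed.

End Reduction.

(** The words with at most one occurrence of the last letter s span the Hecke
    algebra.  Between two consecutive occurrences of s, induction on k leaves at
    most one occurrence of the previous letter t.  All other letters there commute
    with s, so that the two occurrences come together in ss or in sts, and
    [skein_pair] or [skein_triple] lowers the number of occurrences. *)
Lemma skein_reduction k S : skein_closed S ->
  (forall w, letters_lt k w -> (occurrences k.-1 w <= 1)%N -> S w) ->
  forall w, letters_lt k w -> S w.
Proof.
elim: k S => [|k IHk] S hS base; first by case=> //= _; apply: base.
suff main c w : letters_lt k.+1 w -> (occurrences k w <= c.+1)%N -> S w.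
  by move=> w hw; apply: (main (occurrences k w)).
elim: c w => [|c IHc] w hw hc; first exact: base.
case: (leqP (occurrences k w) c.+1) => hc'; first exact: IHc.
have [|u0 [e [w' [def_w hu0 hw' hocc]]]] := first_occurrence hw; first lia.
have [|u1 [f [u2 [def_w' hu1 hu2 hocc']]]] := first_occurrence hw'; first lia.
have hcu2 : (occurrences k u2 <= c)%N by lia.
(* The two leftmost occurrences of k enclose the word u1. *)
rewrite def_w def_w'; move: u1 hu1 {def_w def_w'}.
(* Words with fewer occurrences of k are covered by the induction on their number. *)
have good u v : letters_lt k u -> letters_lt k.+1 v -> (occurrences k v <= c.+1)%N ->
    S (u ++ v).
  rewrite letters_ltS => /andP [hu /eqP hu'] hv hv'; apply: IHc.
    by rewrite letters_lt_cat hu.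
  by rewrite occurrences_cat hu'.
have hctx := @skein_closed_ctx (u0 ++ [:: (k, e)]) ((k, f) :: u2) S hS.
suff h u : letters_lt k u -> (occurrences k.-1 u <= 1)%N ->
    S (u0 ++ (k, e) :: u ++ (k, f) :: u2).
  move=> u hu; have := IHk _ hctx _ u hu; rewrite -!catA; apply=> v hv hv'.
  by rewrite -catA; apply: h.
(* For k = 0 the enclosed word is empty. *)
case: k => [|k] in IHk hw hc hc' hu0 hw' hocc hu2 hocc' hcu2 base IHc good {hctx} *.
  by case: u => //= _ _; apply: skein_pair => //; apply: good => //=; apply: leqW.
move=> /= hu hou.
case: (posnP (occurrences k u)) => [hz|hpos].
  have hu' : letters_lt k u by rewrite letters_ltS hu hz.
  apply: skein_commute_left => //.
  have hu0u : letters_lt k.+1 (u0 ++ u) by rewrite letters_lt_cat hu0.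
  rewrite catA; apply: (skein_pair hS (a := u0 ++ u)); apply: good => //=.
  - exact: leqW.
  - by rewrite ltnSn.
  - by rewrite occurrences_cons eqxx.
have [a [g [b [def_u ha hb hob]]]] := first_occurrence hu hpos.
have {hob hb}hb : letters_lt k b by rewrite letters_ltS hb; lia.
have mono v : letters_lt k v -> letters_lt k.+1 v by apply: sub_all => x /=; lia.
rewrite def_u -catA; apply: skein_commute_left => //.
rewrite catA -[(k.+1, e) :: _]cat1s.
have := skein_commute_right hS (k := k) (e := f) (u := b)
  (a := (u0 ++ a) ++ [:: (k.+1, e); (k, g)]) (b := u2) hb.
rewrite -!catA /=; apply.
rewrite catA.
have hA : letters_lt k.+1 (u0 ++ a) by rewrite letters_lt_cat hu0 mono.
move: (mono _ hb); rewrite letters_ltS => /andP [hb1 /eqP hb2].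
have hv : letters_lt k.+2 (b ++ u2) by rewrite letters_lt_cat hb1.
have hcv : (occurrences k.+1 (b ++ u2) <= c)%N by rewrite occurrences_cat hb2.
have neq : (k == k.+1) = false by lia.
apply: (skein_triple hS (a := u0 ++ a)); apply: good => //=;
  rewrite ?hv ?ltnSn ?leqnSn ?andbT ?occurrences_cons /= ?eqxx ?neq //; lia.
Qed.

(** * Components of a closed braid and cycles of its permutation *)

Lemma iotaSr n : iota 0 n.+1 = rcons (iota 0 n) n.
Proof. by rewrite -addn1 iotaD cats1. Qed.

Lemma nth_cat0 (T : Type) (z : T) a x c : nth z (a ++ x :: c) (size a) = x.
Proof. by rewrite nth_cat ltnn subnn. Qed.

Lemma nth_cat1 (T : Type) (z : T) a x y c :
  nth z (a ++ [:: x, y & c]) (size a).+1 = y.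
Proof. by rewrite -cat_rcons -(size_rcons a x) nth_cat0. Qed.

Lemma splice_cat (T : Type) (a t : seq T) x y c :
  splice (size a) 2 t (a ++ [:: x, y & c]) = a ++ t ++ c.
Proof.
by rewrite /splice take_size_cat // addnC -drop_drop drop_size_cat //= drop0.
Qed.

Section Cycles.
Local Open Scope group_scope.

Lemma card_porbitsJ (T : finType) (s t : {perm T}) :
  #|porbits (s ^ t)| = #|porbits s|.
Proof.
have E x : porbit (s ^ t) (t x) = t @: porbit s x.
  apply/setP=> y; apply/porbitP/imsetP => [[i ->]|[z /porbitP [i ->] ->]].
    by exists ((s ^+ i) x); [apply: mem_porbit | rewrite -conjXg permJ].
  by exists i; rewrite -conjXg permJ.
have -> : porbits (s ^ t) = (fun A : {set T} => t @: A) @: porbits s.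
  apply/setP=> A; apply/imsetP/imsetP => [[y _ ->]|[_ /imsetP [x _ ->] ->]].
    exists (porbit s (t^-1 y)); first exact: imset_f.
    by rewrite -E permKV.
  by exists (t x); rewrite // E.
by apply: card_imset; apply/imset_inj/perm_inj.
Qed.

(** The two products are conjugate. *)
Lemma card_porbitsC (T : finType) (s t : {perm T}) :
  #|porbits (s * t)| = #|porbits (t * s)|.
Proof. by rewrite -(card_porbitsJ (t * s) t) conjgE -mulgA mulKg. Qed.

Lemma card_porbits1 (T : finType) : #|porbits (1 : {perm T})| = #|T|.
Proof.
rewrite card_imset // => x y /eqP; rewrite eq_porbit_mem => /porbitP [i ->].
by rewrite expg1n perm1.
Qed.

Lemma card_porbits_split (T : finType) (s : {perm T}) x y :
  x != y -> x \in porbit s y -> #|porbits (tperm x y * s)| = #|porbits s|.+1.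
Proof.
by move=> ne hx; have := porbits_mul_tperm s x y; rewrite /= ne hx addn0 addn1.
Qed.

Lemma card_porbits_join (T : finType) (s : {perm T}) x y :
  x != y -> x \notin porbit s y -> #|porbits s| = #|porbits (tperm x y * s)|.+1.
Proof.
move=> ne hx; have := porbits_mul_tperm s x y.
by rewrite /= ne hx /= addn1 addn2 => -[].
Qed.

Context (N : nat).
Implicit Types (s : 'S_N.+1) (w : word).

Definition transp i : 'S_N.+1 := tperm (inord i) (inord i.+1).

(** The product is reversed so that the strand at position j above the braid is the
    one at position word_perm w j below it. *)
Fixpoint word_perm w : 'S_N.+1 :=
  if w is x :: w' then word_perm w' * transp x.1 else 1.

Lemma word_perm_cat a b : word_perm (a ++ b) = word_perm b * word_perm a.
Proof. by elim: a => [|x a IH] /=; rewrite ?mulg1 // IH mulgA. Qed.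

Lemma transp_R3 i : (i.+2 <= N)%N ->
  transp i.+1 * transp i * transp i.+1 = transp i * transp i.+1 * transp i.
Proof.
move=> hi.
have J j k : transp j * transp k * transp j = transp k ^ transp j.
  by rewrite conjgE tpermV mulgA.
rewrite !J !tpermJ /transp.
have [n1 n2 n3] : [/\ inord i != inord i.+1 :> 'I_N.+1,
    inord i.+1 != inord i.+2 :> 'I_N.+1 & inord i != inord i.+2 :> 'I_N.+1].
  by rewrite -!val_eqE /= !inordK //; try lia; split; lia.
by rewrite !tpermL !tpermR !tpermD // 1?eq_sym // tpermC.
Qed.

Lemma transp_far i j : (i.+1 < j)%N -> (j < N)%N ->
  transp i * transp j = transp j * transp i.
Proof.
move=> hij hj.
have ne a b : (a <= N)%N -> (b <= N)%N -> (a != b)%N -> inord a != inord b :> 'I_N.+1.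
  by move=> ha hb; rewrite -val_eqE /= !inordK.
apply/commute_sym/commgP/conjg_fixP; rewrite tpermJ !tpermD //; apply: ne; lia.
Qed.

(** Smoothing removes a transposition from the product.  Up to conjugation it
    stands in front, where it splits a cycle or joins two. *)
Lemma card_porbits_smoothing a i e b : (i.+1 <= N)%N ->
  (#|porbits (word_perm (a ++ (i, e) :: b))| == #|porbits (word_perm (a ++ b))|.+1)
  || (#|porbits (word_perm (a ++ (i, e) :: b))|.+1 == #|porbits (word_perm (a ++ b))|).
Proof.
move=> hi; rewrite !word_perm_cat /= card_porbitsC mulgA card_porbitsC.
rewrite (card_porbitsC (word_perm b)) /transp.
have ne : inord i != inord i.+1 :> 'I_N.+1.
  by rewrite -val_eqE /= !inordK; lia.
case: (boolP (inord i \in porbit (word_perm a * word_perm b) (inord i.+1))) => h.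
  by rewrite card_porbits_split // eqxx.
by rewrite (card_porbits_join ne h) eqxx orbT.
Qed.

Lemma word_perm_fix n w (x : 'I_N.+1) : is_word n w -> (n <= N.+1)%N -> (n <= x)%N ->
  word_perm w x = x.
Proof.
elim: w => [|[i e] w IH] /=; first by rewrite perm1.
move=> /andP [hi hw] hn hx; rewrite permM IH //.
by rewrite tpermD // -val_eqE /= inordK; lia.
Qed.

Lemma card_porbits_stab n w e : is_word n.+1 w -> (n.+1 <= N)%N ->
  #|porbits (word_perm w)| = #|porbits (word_perm (w ++ [:: (n, e)]))|.+1.
Proof.
move=> hw hn; rewrite word_perm_cat /= mul1g.
have fx : word_perm w (inord n.+1) = inord n.+1.
  by apply: word_perm_fix hw _ _; rewrite ?inordK //; lia.
have ne : inord n != inord n.+1 :> 'I_N.+1.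
  by rewrite -val_eqE /= !inordK; lia.
apply: card_porbits_join => //.
by apply: contra ne => /porbitP [k ->]; rewrite permX iter_fix.
Qed.

(** The state of the component count whose j-th strand continues the arc that
    starts at position s j. *)
Definition labels s k := [seq (s (inord j) : nat) | j <- iota 0 k].

Lemma count_cups c k m D : c = k ->
  count_components c (iota 0 k ++ rev (iota 0 k))
    ([seq (i, Cup true) | i <- iota k m] ++ D) =
  count_components (k + m) (iota 0 (k + m) ++ rev (iota 0 (k + m))) D.
Proof.
elim: m c k => [|m IH] c k -> /=; first by rewrite addn0.
have -> : splice k 0 [:: k; k] (iota 0 k ++ rev (iota 0 k)) =
    iota 0 k.+1 ++ rev (iota 0 k.+1).
  rewrite /splice addn0 take_size_cat ?drop_size_cat ?size_iota //.
  by rewrite -addn1 iotaD rev_cat /= -catA.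
by rewrite IH // addSnnS.
Qed.

Lemma count_crossings c s r w D : is_word N.+1 w ->
  count_components c (labels s N.+1 ++ r) (crossings w ++ D) =
  count_components c (labels (word_perm w * s) N.+1 ++ r) D.
Proof.
elim: w s => [|[i e] w IH] s; first by rewrite mul1g.
case/andP=> hi hw; have {}hi : (i.+1 < N.+1)%N := hi.
rewrite [word_perm _]/= -mulgA -IH //.
rewrite -[LHS]/(count_components c (splice i 2 [:: _; _] _) (crossings w ++ D)).
congr (count_components _ _ _).
have E t : labels t N.+1 ++ r = [seq (t (inord j) : nat) | j <- iota 0 i]
   ++ [:: val (t (inord i)); val (t (inord i.+1))] ++
   [seq (t (inord j) : nat) | j <- iota i.+2 (N.+1 - i.+2)] ++ r.
  rewrite /labels.
  have -> : iota 0 N.+1 = iota 0 i ++ [:: i; i.+1] ++ iota i.+2 (N.+1 - i.+2).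
    by rewrite -[_ ++ iota i.+2 _]/(iota i (2 + _)) -(@iotaD 0 i); congr iota; lia.
  by rewrite !map_cat -!catA.
rewrite !E; set a := [seq _ | j <- iota 0 i]; set b := [seq _ | j <- iota i.+2 _].
have ha : i = size a by rewrite size_map size_iota.
have := (nth_cat0 0%N a, nth_cat1 0%N a, splice_cat a).
rewrite -ha => -[[h0 h1] h2]; rewrite h0 h1 h2 /a /b.
rewrite !permM tpermL tpermR; congr (_ ++ _ :: _ :: _ ++ _);
  apply/eq_in_map => j; rewrite mem_iota => hj;
  by rewrite permM tpermD // -val_eqE /= !inordK; lia.
Qed.

(** Each cap removes a point from the permutation.  A fixed point is a finished
    component; otherwise the relabelling is the product with a transposition that
    splits the point off as a new cycle, and the numbers of cycles and of points
    to remove change together. *)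
Lemma count_caps c s k : (k <= N.+1)%N ->
  (forall x : 'I_N.+1, (k <= x)%N -> s x = x) ->
  (count_components c (labels s k ++ rev (iota 0 k)) (caps k) + N.+1 =
   #|porbits s| + k)%N.
Proof.
elim: k s => [|k IH] s hk fx.
  have -> : s = 1 by apply/permP=> x; rewrite fx // perm1.
  by rewrite card_porbits1 card_ord addn0.
have hs t j : size (labels t j) = j by rewrite size_map size_iota.
have hrev : rev (iota 0 k.+1) = k :: rev (iota 0 k).
  by rewrite iotaSr rev_rcons.
have hlab : labels s k.+1 = rcons (labels s k) (s (inord k)).
  by rewrite /labels iotaSr map_rcons.
have := (nth_cat0 0%N (labels s k), nth_cat1 0%N (labels s k), splice_cat (labels s k)).
rewrite capsS hrev hlab cat_rcons hs; move def_a: (labels s k) => a [[h0 h1] h2] /=.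
rewrite h0 h1 h2 -def_a {a def_a h0 h1 h2}.
case: eqP => [def_k|/eqP ne_k].
  rewrite addSn IH ?addnS //; first exact: ltnW.
  move=> x; rewrite leq_eqVlt => /orP [/eqP hx|]; last exact: fx.
  have -> : x = inord k by apply: val_inj; rewrite /= inordK // -hx.
  by apply: val_inj; rewrite /= def_k inordK.
set t := tperm (inord k) (s (inord k)).
have -> : [seq (if u == k then (s (inord k) : nat) else u)
              | u <- labels s k ++ rev (iota 0 k)]
   = labels (s * t) k ++ rev (iota 0 k).
  rewrite map_cat; congr (_ ++ _).
    rewrite -map_comp; apply/eq_in_map => j; rewrite mem_iota /= add0n => hj.
    rewrite permM /t; case: tpermP => [->|/perm_inj h|/eqP h1 h2].
    - by rewrite inordK // eqxx.
    - by move/(congr1 val): h; rewrite /= !inordK; lia.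
    - by rewrite -(inordK hk) val_eqE (negbTE h1).
  rewrite -[RHS]map_id; apply/eq_in_map => j; rewrite mem_rev mem_iota.
  by case: eqP; lia.
rewrite IH //; last 2 first.
- exact: ltnW.
- move=> x; rewrite permM leq_eqVlt => /orP [/eqP hx|hx].
    have -> : x = inord k by apply: val_inj; rewrite /= inordK // -hx.
    by rewrite /t tpermR.
  rewrite fx // tpermD //; first by rewrite -val_eqE /= inordK; lia.
  apply: contraTneq hx => def_x; move: (fx x); rewrite -def_x.
  rewrite -leqNgt; case: leqP => // h /(_ isT) /perm_inj /(congr1 val) /=.
  by rewrite inordK //; move: h; lia.
rewrite card_porbitsC.
rewrite card_porbits_split ?addSnnS //.
  by rewrite -val_eqE /= inordK // eq_sym.
by rewrite porbit_sym; have := mem_porbit s 1 (inord k); rewrite expg1.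
Qed.

Lemma ncomponents_closure w : is_word N.+1 w ->
  ncomponents (word_closure N.+1 w) = #|porbits (word_perm w)|.
Proof.
move=> hw; rewrite /ncomponents /word_closure.
have := @count_cups 0 0 N.+1 (crossings w ++ caps N.+1) erefl.
rewrite !add0n => h; rewrite [count_components _ _ _]h.
have labels1 : labels 1 N.+1 = iota 0 N.+1.
  rewrite /labels -[RHS]map_id; apply/eq_in_map => j; rewrite mem_iota => hj.
  by rewrite perm1 inordK.
rewrite -labels1 count_crossings // mulg1 labels1.
apply: (@ssrnat.addIn N.+1); apply: count_caps => // x.
by rewrite leqNgt ltn_ord.
Qed.

End Cycles.

(** * Behaviour of the four properties under skein relations *)

Lemma coef_vzmul a b p x y : (vzmul a b p)@_(x, y) = p@_(x - a, y - b).
Proof.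
rewrite raddf_sum [in RHS](monalgE p) raddf_sum; apply: eq_bigr => -[s t] _ /=.
rewrite !mcoeffU !xpair_eqE; congr (_ *+ (_ && _)); lia.
Qed.

Section Evaluation.
Context (F : fieldType) (v : F).
Context (v_neq0 : v != 0) (z_neq0 : v^-1 - v != 0).
(* The value z0 at which the skein relation is satisfied by the constant 1. *)
Local Notation z := (v^-1 - v).

(** The value of P at z = z0 and the coefficient of a power of z in P are both sums
    over the support with weights in a field. *)
Definition weighted_sum (h : int * int -> F) : laurent_vz -> F := mmap intr h.

Lemma weighted_sumE h p :
  weighted_sum h p = \sum_(k <- msupp p) (p@_k)%:~R * h k.
Proof. by []. Qed.

Lemma weighted_sum_vzmul h a b p :
  weighted_sum h (vzmul a b p) = weighted_sum (fun k => h (a + k.1, b + k.2)) p.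
Proof.
by rewrite /weighted_sum raddf_sum; apply: eq_bigr => k _; rewrite /= mmapU.
Qed.

Definition int_eval (r : {poly int}) : F := (map_poly intr r).[v].

(** Integral Laurent polynomials in v with value 1 at v = 1; the power of v clears
    the denominator. *)
Definition unit_at1 (x : F) : Prop :=
  exists (N : nat) (r : {poly int}), r.[1] = 1 /\ x * v ^+ N = int_eval r.

Lemma unit_at1_vM a x : unit_at1 x -> unit_at1 (v ^ a * x).
Proof.
case=> N [r [r1 hr]]; case: a => k.
  exists N, ('X ^+ k * r); rewrite hornerM hornerXn expr1n mul1r; split=> //.
  by rewrite -mulrA hr /int_eval rmorphM /= map_polyXn hornerM hornerXn.
exists (N + k.+1)%N, r; split=> //; rewrite exprD -hr -[v ^ _]/(v ^- k.+1).
have : v ^+ k.+1 != 0 by rewrite expf_neq0.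
by move: (v ^+ k.+1) => a ha; field.
Qed.

(** The added term vanishes at v = 1 because v z0 = 1 - v^2. *)
Lemma unit_at1_add x y (e : int) :
  unit_at1 x -> unit_at1 y -> unit_at1 (x + e%:~R * (v * z) * y).
Proof.
case=> N [r [r1 hr]] [M [s [s1 hs]]].
exists (N + M)%N, (r * 'X ^+ M + e%:P * (1 - 'X ^+ 2) * s * 'X ^+ N); split.
  by rewrite !(hornerD, hornerM, hornerN, hornerC, hornerX, hornerXn) r1 s1 !expr1n; ring.
rewrite /int_eval !(rmorphD, rmorphN, rmorphM, rmorphXn) /= map_polyX map_polyC rmorph1.
rewrite !hornerE /= -/(int_eval r) -/(int_eval s) -hr -hs exprD.
by move: (v ^+ N) (v ^+ M) => a b; field.
Qed.

Definition eval_at (k : int * int) : F := v ^ k.1 * z ^ k.2.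
Definition slice_at (b : int) (k : int * int) : F :=
  (k.2 == b)%:R * v ^ k.1.

Lemma eval_vzmul a b p : weighted_sum eval_at (vzmul a b p) =
  v ^ a * z ^ b * weighted_sum eval_at p.
Proof.
rewrite weighted_sum_vzmul !weighted_sumE mulr_sumr; apply: eq_bigr => k _.
by rewrite /eval_at /= !expfzDr ?v_neq0 ?z_neq0 //; ring.
Qed.

Lemma slice_vzmul a c b p : weighted_sum (slice_at b) (vzmul a c p) =
  v ^ a * weighted_sum (slice_at (b - c)) p.
Proof.
rewrite weighted_sum_vzmul !weighted_sumE mulr_sumr; apply: eq_bigr => k _.
rewrite /slice_at /= !expfzDr ?v_neq0 //.
have -> : (c + k.2 == b) = (k.2 == b - c) by lia.
by ring.
Qed.

(** The four properties, with n, w and mu in the roles of the number of strands, the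
    writhe and the number of components. *)
Record skein_shape (n : nat) (w mu : int) (p : laurent_vz) : Prop := {
  shape_v : forall k, k \in msupp p -> exists j : nat, w + n%:Z - 1 = k.1 + 2 * j%:Z;
  shape_eval : weighted_sum eval_at p = 1;
  shape_z : forall k, k \in msupp p -> 1 - mu <= k.2;
  shape_slice : exists x, unit_at1 x /\
    weighted_sum (slice_at (1 - mu)) p = z ^ (mu - 1) * x
}.

Lemma slice0 n w mu p b : skein_shape n w mu p -> b < 1 - mu ->
  weighted_sum (slice_at b) p = 0.
Proof.
move=> hp hb; rewrite weighted_sumE big_seq big1 // => k /(shape_z hp) hk.
by rewrite /slice_at (_ : (k.2 == b) = false) ?mul0r ?mulr0 //; lia.
Qed.

(** The skein relation solved for the positive (e = 1) or the negative (e = -1)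
    crossing.  If the smoothing joins two components, its polynomial starts at
    z^(2-mu) and contributes, after multiplication by z, nothing to z^(1-mu).  If
    it splits a component, it contributes a multiple of v z0 = 1 - v^2, which
    vanishes at v = 1. *)
Lemma skein_shape_step n w (mu mu0 e : int) p p0 : e = 1 \/ e = -1 ->
  mu0 = mu + 1 \/ mu0 = mu - 1 ->
  skein_shape n w mu p -> skein_shape n (w + e) mu0 p0 ->
  skein_shape n (w + 2 * e) mu (vzmul (2 * e) 0 p + vzmul e 1 p0 *~ e).
Proof.
move=> he hmu hp hp0.
have := (coef_vzmul (2 * e) 0 p, eval_vzmul (2 * e) 0 p, slice_vzmul (2 * e) 0 ^~ p).
move: (vzmul _ _ p) => q [[coef_q eval_q] slice_q].
have := (coef_vzmul e 1 p0, eval_vzmul e 1 p0, slice_vzmul e 1 ^~ p0).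
move: (vzmul _ _ p0) => q0 [[coef_q0 eval_q0] slice_q0].
have supp k : k \in msupp (q + q0 *~ e) ->
    (k.1 - 2 * e, k.2 - 0) \in msupp p \/ (k.1 - e, k.2 - 1) \in msupp p0.
  case: k => x y; rewrite -!mcoeff_neq0 mcoeffD raddfMz /= coef_q coef_q0.
  case: (eqVneq p@_(x - 2 * e, y - 0) 0) => [->|]; last by left.
  by rewrite add0r => h; right; apply: contraNneq h => ->; rewrite mul0rz.
have vz : v ^ (2 * e) + v ^ e * z * e%:~R = 1.
  case: he => ->; first by rewrite -[v ^ _]/(v ^+ 2) expr1z mulr1z; field.
  by rewrite -[v ^ (2 * -1)]/(v ^- 2) -[v ^ -1]/(v^-1) mulrN1z; field.
have split h : weighted_sum h (q + q0 *~ e) =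
    weighted_sum h q + weighted_sum h q0 * e%:~R.
  by rewrite /weighted_sum raddfD raddfMz -mulrzr.
split.
- by move=> k /supp [/(shape_v hp)|/(shape_v hp0)] /= [j hj]; exists j; lia.
- rewrite split eval_q eval_q0 (shape_eval hp) (shape_eval hp0).
  by rewrite !mulr1 ?expr0z ?mulr1 expr1z.
- by move=> k /supp [/(shape_z hp)|/(shape_z hp0)] /=; lia.
- rewrite split slice_q slice_q0 subr0.
  have [x [hx ->]] := shape_slice hp.
  case: hmu => def_mu0; last first.
    exists (v ^ (2 * e) * x); split; first exact: unit_at1_vM.
    by rewrite (slice0 hp0) ?mulr0 ?mul0r ?addr0 1?mulrCA //; lia.
  have [y [hy def_y]] := shape_slice hp0.
  have -> : 1 - mu - 1 = 1 - mu0 by lia.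
  exists (v ^ (2 * e) * x + e%:~R * (v * z) * (v ^ (e - 1) * y)).
  split; first by apply: unit_at1_add; apply: unit_at1_vM.
  rewrite def_y def_mu0.
  have -> : z ^ (mu + 1 - 1) = z ^ (mu - 1) * z.
    by rewrite -{3}[z]expr1z -expfzDr //; congr (_ ^ _); ring.
  have -> : v ^ e = v * v ^ (e - 1).
    by rewrite -{2}[v]expr1z -expfzDr //; congr (_ ^ _); ring.
  move: (z ^ (mu - 1)) (v ^ (e - 1)) (v ^ (2 * e)) => a b c.
  by ring.
Qed.

(** The hypothesis is the skein relation in which the two crossings have the same
    polynomial p; it says that p0 is p times z0 / z. *)
Lemma skein_shape_split n w mu p p0 :
  p = vzmul 1 1 p0 + vzmul 2 0 p -> skein_shape n w mu p ->
  skein_shape n.+1 w (mu + 1) p0.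
Proof.
have := (coef_vzmul 1 1 p0, eval_vzmul 1 1 p0, slice_vzmul 1 1 ^~ p0).
move: (vzmul _ _ p0) => q0 [[coef_q0 eval_q0] slice_q0].
have := (coef_vzmul 2 0 p, eval_vzmul 2 0 p, slice_vzmul 2 0 ^~ p).
move: (vzmul _ _ p) => q [[coef_q eval_q] slice_q] def_p hp.
have {}def_p : q0 = p - q by rewrite def_p addrK.
have vz : 1 - v ^ 2 = v * z by rewrite -[v ^ 2]/(v ^+ 2); field.
have supp k : k \in msupp p0 ->
    (k.1 + 1, k.2 + 1) \in msupp p \/ (k.1 + 1 - 2, k.2 + 1) \in msupp p.
  rewrite -!mcoeff_neq0; case: k => x y /= h.
  have := coef_q0 (x + 1) (y + 1).
  rewrite def_p mcoeffB coef_q !addrK subr0 => def_c.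
  case: (eqVneq p@_(x + 1, y + 1) 0) => [h0|]; last by left.
  by right; apply: contraNneq h => h1; rewrite -def_c h0 h1 subrr.
have split h : weighted_sum h q0 = weighted_sum h p - weighted_sum h q.
  by rewrite def_p /weighted_sum raddfB.
split.
- move=> k /supp [] /(shape_v hp) /= [j hj]; last by exists j; lia.
  by exists j.+1; lia.
- have := split eval_at; rewrite eval_q0 eval_q (shape_eval hp) !mulr1 vz.
  by rewrite -[RHS]mulr1 => /mulfI; apply; rewrite mulf_neq0.
- by move=> k /supp [] /(shape_z hp) /=; lia.
- have := split (slice_at (1 - mu)); rewrite slice_q0 slice_q subr0.
  have -> : 1 - mu - 1 = 1 - (mu + 1) by lia.
  have [x [hx ->]] := shape_slice hp.
  rewrite -{1}[_ * x]mul1r -mulrBl vz -mulrA => /(mulfI v_neq0) ->.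
  exists x; split=> //; rewrite mulrA; congr (_ * x).
  by rewrite -{1}[z]expr1z -expfzDr //; congr (_ ^ _); ring.
Qed.

(** The bound w + n - 1 on the exponents of v grows by 1 + e, which is 0 or 2. *)
Lemma skein_shape_stab n w mu p (e : int) : e = 1 \/ e = -1 ->
  skein_shape n w mu p -> skein_shape n.+1 (w + e) mu p.
Proof.
move=> he [h1 h2 h3 h4]; split=> // k /h1 [j hj].
by case: he => ->; [exists j.+1 | exists j]; clear -hj; lia.
Qed.

Lemma skein_shape_unknot : skein_shape 1 0 1 << (0, 0) >>.
Proof.
have supp k : k \in msupp (<< (0, 0) >> : laurent_vz) -> k = (0, 0).
  by rewrite msuppU oner_eq0 in_fset1 => /eqP.
split.
- by move=> k /supp ->; exists 0%N.
- by rewrite /weighted_sum mmapU /= mul1r /eval_at !expr0z mul1r.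
- by move=> k /supp ->.
- rewrite subrr /weighted_sum mmapU /= /slice_at eqxx !expr0z !mul1r; exists 1.
  split; last by rewrite mul1r.
  by exists 0%N, 1; rewrite /int_eval rmorph1 !hornerC expr0 mul1r.
Qed.

End Evaluation.

(** * The four properties of closed braids *)

Definition word_writhe (w : word) : int := \sum_(x <- w) (if x.2 then 1 else -1).

Lemma word_writhe_cat a b : word_writhe (a ++ b) = word_writhe a + word_writhe b.
Proof. by rewrite /word_writhe big_cat. Qed.

Lemma word_writhe_cons x w :
  word_writhe (x :: w) = (if x.2 then 1 else -1) + word_writhe w.
Proof. by rewrite /word_writhe big_cons. Qed.

(** The skein relation solved for the negative crossing. *)
Lemma vzmul_solve p p0 q : p = vzmul 1 1 p0 + vzmul 2 0 q ->
  q = vzmul (2 * -1) 0 p + vzmul (-1) 1 p0 *~ -1.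
Proof.
have := (coef_vzmul 1 1 p0, coef_vzmul 2 0 q).
move: (vzmul 1 1 p0) (vzmul 2 0 q) => p1 q1 [coef_p1 coef_q1] def_p.
have := (coef_vzmul (2 * -1) 0 p, coef_vzmul (-1) 1 p0).
move: (vzmul _ _ p) (vzmul _ _ p0) => p2 p3 [coef_p2 coef_p3].
apply/malgP => -[x y]; rewrite mcoeffD raddfMz /= coef_p2 coef_p3 def_p.
rewrite mcoeffD coef_p1 coef_q1 mulrN1z addrAC.
have -> : x - 2 * -1 - 1 = x - -1 by ring.
have -> : x - 2 * -1 - 2 = x by ring.
by rewrite !subr0 subrr add0r.
Qed.

Section Induction.
Context (P : diagram -> laurent_vz) (hP : is_homflypt P).
Context (F : fieldType) (v : F).
Context (v_neq0 : v != 0) (z_neq0 : v^-1 - v != 0).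
Context (N : nat).

Definition cycles (w : word) : nat := #|porbits (word_perm N w)|.

(** The permutation acts on N + 1 points for all n, so that different n can be
    compared.  The N + 1 - n points outside the braid are fixed, and these cycles
    are not components. *)
Definition closure_shape n w : Prop :=
  skein_shape v n (word_writhe w) ((cycles w)%:Z + n%:Z - N.+1%:Z)
    (P (word_closure n w)).

Lemma closure_shape_flip n a i e b : (n <= N.+1)%N ->
  is_word n (a ++ (i, e) :: b) -> closure_shape n (a ++ b) ->
  closure_shape n (a ++ (i, ~~ e) :: b) -> closure_shape n (a ++ (i, e) :: b).
Proof.
move=> hn hw; rewrite /closure_shape.
have hi : (i.+1 <= N)%N.
  by move: hw; rewrite (is_word_cat _ a) /= => /and3P [_ hi _]; lia.
have hw' f : is_word n (a ++ (i, f) :: b) by move: hw; rewrite !is_word_cat.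
have wr f : word_writhe (a ++ (i, f) :: b) = (if f then 1 else -1) + word_writhe (a ++ b).
  by rewrite !word_writhe_cat word_writhe_cons addrCA.
have cyc f : cycles (a ++ (i, f) :: b) = cycles (a ++ (i, e) :: b).
  by rewrite /cycles !word_perm_cat.
have hc := card_porbits_smoothing a e b hi.
rewrite -!/(cycles _) in hc.
have hskein := word_closure_skein hP (hw' true).
rewrite cyc !wr; move: (P (word_closure n (a ++ b))) hskein => p0.
move: (cycles (a ++ (i, e) :: b)) (cycles (a ++ b)) hc => c c0 hc hskein h0 h1.
have hmu : (c0%:Z + n%:Z - N.+1%:Z = c%:Z + n%:Z - N.+1%:Z + 1) \/
    (c0%:Z + n%:Z - N.+1%:Z = c%:Z + n%:Z - N.+1%:Z - 1).
  by case/orP: hc => /eqP hc; [right|left]; lia.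
case: e h1 {hw cyc} => /= h1.
  have := skein_shape_step v_neq0 z_neq0 (or_introl erefl) hmu h1.
  rewrite (_ : -1 + word_writhe (a ++ b) + 1 = word_writhe (a ++ b)); last ring.
  move=> /(_ p0 h0); rewrite mulr1z mulr1 (addrC (vzmul _ _ _)) -hskein.
  by rewrite (_ : -1 + word_writhe (a ++ b) + 2 = 1 + word_writhe (a ++ b)) //; ring.
have := skein_shape_step v_neq0 z_neq0 (or_intror erefl) hmu h1.
rewrite (_ : 1 + word_writhe (a ++ b) - 1 = word_writhe (a ++ b)); last ring.
move=> /(_ p0 h0); rewrite -(vzmul_solve hskein).
by rewrite (_ : 1 + word_writhe (a ++ b) + 2 * -1 = -1 + word_writhe (a ++ b)) //; ring.
Qed.

Lemma closure_shape_skein_closed n : (n <= N.+1)%N ->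
  skein_closed (fun w => is_word n w -> closure_shape n w).
Proof.
move=> hn; split.
- move=> a i e b h0 h1 hw; apply: closure_shape_flip => //.
    by apply: h0; move: hw; rewrite !(is_word_cat _ a) /= => /and3P [-> _ ->].
  by apply: h1; move: hw; rewrite !is_word_cat.
- move=> a i e b h hw; rewrite /closure_shape word_closure_R2 //.
  have -> : cycles (a ++ [:: (i, e); (i, ~~ e)] ++ b) = cycles (a ++ b).
    by rewrite /cycles !word_perm_cat /= mul1g tperm2 mulg1.
  have -> : word_writhe (a ++ [:: (i, e); (i, ~~ e)] ++ b) = word_writhe (a ++ b).
    rewrite !word_writhe_cat !word_writhe_cons /word_writhe big_nil.
    by case: e {h hw} => /=; ring.
  by apply: h; move: hw; rewrite !(is_word_cat _ a) /= => /and4P [-> _ _ ->].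
- move=> a i e b h hw; rewrite /closure_shape word_closure_R3 //.
  have hi : (i.+2 <= N)%N.
    by move: hw; rewrite (is_word_cat _ a) /= => /and5P [_ hi _ _ _]; lia.
  have -> : cycles (a ++ [:: (i.+1, e); (i, e); (i.+1, e)] ++ b) =
      cycles (a ++ [:: (i, e); (i.+1, e); (i, e)] ++ b).
    by rewrite /cycles !word_perm_cat /= !mul1g transp_R3.
  have -> : word_writhe (a ++ [:: (i.+1, e); (i, e); (i.+1, e)] ++ b) =
      word_writhe (a ++ [:: (i, e); (i.+1, e); (i, e)] ++ b).
    by rewrite !word_writhe_cat !word_writhe_cons.
  by apply: h; move: hw; rewrite !(is_word_cat _ a) /= => /and5P [-> -> -> _ ->].
- move=> a i j e f b hij h hw; rewrite /closure_shape word_closure_far //.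
  have [hi hj] : (i < N)%N /\ (j < N)%N.
    by move: hw; rewrite (is_word_cat _ a) /= => /and4P [_ hi hj _]; lia.
  have -> : cycles (a ++ [:: (i, e); (j, f)] ++ b) =
      cycles (a ++ [:: (j, f); (i, e)] ++ b).
    rewrite /cycles !word_perm_cat /= !mul1g; case/orP: hij => hij.
      by rewrite (transp_far hij hj).
    by rewrite (transp_far hij hi).
  have -> : word_writhe (a ++ [:: (i, e); (j, f)] ++ b) =
      word_writhe (a ++ [:: (j, f); (i, e)] ++ b).
    by rewrite !word_writhe_cat !word_writhe_cons; ring.
  by apply: h; move: hw; rewrite !(is_word_cat _ a) /= => /and4P [-> -> -> ->].
Qed.

Lemma closure_shape_stab n w e : (n.+2 <= N.+1)%N -> is_word n.+1 w ->
  closure_shape n.+1 w -> closure_shape n.+2 (w ++ [:: (n, e)]).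
Proof.
move=> hn hw h; rewrite /closure_shape word_closure_stab //.
have def_c : cycles w = (cycles (w ++ [:: (n, e)])).+1 by apply: card_porbits_stab.
have -> : (cycles (w ++ [:: (n, e)]))%:Z + n.+2%:Z - N.+1%:Z =
   (cycles w)%:Z + n.+1%:Z - N.+1%:Z by rewrite def_c; lia.
rewrite word_writhe_cat [word_writhe [:: _]]big_seq1 /=.
by apply: skein_shape_stab h; case: e {def_c}; [left|right].
Qed.

(** The word w in n + 2 strands is the smoothing of both its stabilizations. *)
Lemma closure_shape_split n w : is_word n.+1 w ->
  closure_shape n.+1 w -> closure_shape n.+2 w.
Proof.
move=> hw h; rewrite /closure_shape.
have -> : (cycles w)%:Z + n.+2%:Z - N.+1%:Z =
   (cycles w)%:Z + n.+1%:Z - N.+1%:Z + 1 by lia.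
apply: (skein_shape_split v_neq0 z_neq0 _ h).
have := @word_closure_skein P hP n.+2 w n [::].
rewrite !word_closure_stab // cats0; apply.
rewrite is_word_cat /= !ltnS leqnn !andbT.
by apply: sub_all hw => x /=; lia.
Qed.

Lemma closure_shape_conj n a b : is_word n (a ++ b) ->
  closure_shape n (b ++ a) -> closure_shape n (a ++ b).
Proof.
move=> hw; rewrite /closure_shape (word_closure_conj hP hw).
rewrite !word_writhe_cat addrC /cycles !word_perm_cat.
by rewrite card_porbitsC.
Qed.

Theorem closure_shapeP n w : (n.+1 <= N.+1)%N -> is_word n.+1 w ->
  closure_shape n.+1 w.
Proof.
elim: n w => [|n IH] w hn hw.
  case: w hw => // _; rewrite /closure_shape /cycles /= card_porbits1 card_ord.
  rewrite (_ : word_closure 1 [::] = unknot) // (homflypt_unknot hP).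
  rewrite /word_writhe big_nil (_ : N.+1%:Z + 1%:Z - N.+1%:Z = 1); last lia.
  exact: skein_shape_unknot.
have is_wordE u : is_word n.+1 u = letters_lt n u by [].
apply: (skein_reduction (closure_shape_skein_closed hn) _ (k := n.+1)) => // {hw}w.
move=> hw hocc hw'; case: (posnP (occurrences n w)) => hpos.
  apply: closure_shape_split; last apply: IH; rewrite ?(ltnW hn) // is_wordE;
    by rewrite letters_ltS hw hpos.
have [u [e [x [def_w hu hx hx']]]] := first_occurrence hw hpos.
have {hx' hx}hx : letters_lt n x.
  by rewrite letters_ltS hx -leqn0 -ltnS -hx'.
move: hw'; rewrite def_w -cat1s catA => hw'.
apply: closure_shape_conj => //; rewrite catA.
have hxu : is_word n.+1 (x ++ u) by rewrite is_word_cat !is_wordE hu hx.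
by apply: closure_shape_stab => //; apply: IH => //; apply: ltnW.
Qed.

End Induction.

(** * Clearing denominators *)

(** This is v^(a+b) z0^b, since v z0 = 1 - v^2. *)
Definition cleared_monomial (a b : nat) : {poly int} := 'X ^+ a * (1 - 'X ^+ 2) ^+ b.

Lemma size_1subX2 : size (1 - 'X ^+ 2 : {poly int}) = 3.
Proof. by rewrite -opprB size_polyN size_XnsubC. Qed.

Lemma sub1X2_neq0 : (1 - 'X ^+ 2 : {poly int}) != 0.
Proof. by rewrite -size_poly_eq0 size_1subX2. Qed.

Lemma size_cleared_monomial a b : size (cleared_monomial a b) = (a + b.*2).+1.
Proof.
have h : (1 - 'X ^+ 2 : {poly int}) ^+ b != 0 by rewrite expf_neq0 ?sub1X2_neq0.
rewrite /cleared_monomial mulrC size_mulXn //.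
move: h; rewrite -size_poly_gt0 => /prednK <-; rewrite size_exp size_1subX2.
by rewrite mul2n addnS.
Qed.

Lemma coef_cleared_monomial a b : (cleared_monomial a b)`_(a + b.*2) = (-1) ^+ b.
Proof.
have := lead_coefE (cleared_monomial a b); rewrite size_cleared_monomial => <-.
rewrite lead_coefM lead_coefXn mul1r lead_coef_exp -opprB lead_coefN.
by rewrite lead_coefXnsubC.
Qed.

Section Denominators.
Context (F : fieldType) (v : F).
Context (v_neq0 : v != 0) (z_neq0 : v^-1 - v != 0).
Local Notation z := (v^-1 - v).

Lemma int_evalM r s : int_eval v (r * s) = int_eval v r * int_eval v s.
Proof. by rewrite /int_eval rmorphM hornerM. Qed.

Lemma int_eval_sum (I : eqType) (s : seq I) (Q : pred I) (f : I -> {poly int}) :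
  int_eval v (\sum_(i <- s | Q i) f i) = \sum_(i <- s | Q i) int_eval v (f i).
Proof. by rewrite /int_eval rmorph_sum horner_sum. Qed.

Lemma int_evalC c : int_eval v c%:P = c%:~R.
Proof. by rewrite /int_eval map_polyC hornerC. Qed.

Lemma int_evalXn k : int_eval v ('X ^+ k) = v ^+ k.
Proof. by rewrite /int_eval map_polyXn hornerXn. Qed.

Lemma int_eval_binom a b : int_eval v (cleared_monomial a b) = v ^+ a * (v * z) ^+ b.
Proof.
rewrite int_evalM int_evalXn /int_eval rmorphXn horner_exp; congr (_ * _ ^+ _).
rewrite rmorphB rmorph1 /= map_polyXn !hornerE.
by field.
Qed.

(** Multiplication by v^A z0^B turns both sides of P(v, z0) = 1 into polynomials
    in v, and a term v^a z^b of P into one of degree a + b + A + B. *)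
Lemma eval_cleared (A B : nat) p : (2 * B <= A)%N ->
  (forall k, k \in msupp p -> `|k.2| <= B%:Z /\ `|k.1| + 2 * B%:Z <= A%:Z) ->
  weighted_sum (eval_at v) p = 1 ->
  int_eval v (\sum_(k <- msupp p) (p@_k)%:P *
     cleared_monomial `|k.1 - k.2 - B%:Z + A%:Z| `|k.2 + B%:Z|) =
  int_eval v (cleared_monomial (A - B) B).
Proof.
move=> hAB hk hp.
have -> : int_eval v (cleared_monomial (A - B) B) = v ^ A%:Z * z ^ B%:Z.
  by rewrite int_eval_binom exprMn mulrA -exprD subnK //; lia.
rewrite -[RHS]mulr1 -hp weighted_sumE mulr_sumr int_eval_sum.
rewrite !big_seq; apply: eq_bigr => k /hk [hk2 hk1].
rewrite int_evalM int_evalC int_eval_binom exprMn [v ^+ _ * _]mulrA -exprD /eval_at.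
have -> : v ^+ (`|k.1 - k.2 - B%:Z + A%:Z| + `|k.2 + B%:Z|) = v ^ A%:Z * v ^ k.1.
  by rewrite -expfzDr // exprnP; congr (_ ^ _); lia.
have -> : z ^+ `|k.2 + B%:Z| = z ^ B%:Z * z ^ k.2.
  by rewrite -expfzDr // exprnP; congr (_ ^ _); lia.
move: (v ^ A%:Z) (v ^ k.1) (z ^ B%:Z) (z ^ k.2) => *; ring.
Qed.

Lemma slice_cleared (x b : int) p : (forall k, k \in msupp p -> x <= k.1) ->
  weighted_sum (slice_at v b) p =
  v ^ x * int_eval v (\sum_(k <- msupp p | k.2 == b) (p@_k)%:P * 'X ^+ `|k.1 - x|).
Proof.
move=> hx; rewrite int_eval_sum mulr_sumr weighted_sumE [RHS]big_mkcond.
rewrite !big_seq; apply: eq_bigr => k /hx hk; rewrite /slice_at.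
case: eqP => _; last by rewrite mul0r mulr0.
rewrite int_evalM int_evalC int_evalXn mul1r mulrCA; congr (_ * _).
rewrite exprnP -expfzDr //; congr (_ ^ _).
by rewrite gez0_abs ?subr_ge0 // addrCA subrr addr0.
Qed.

(** The powers of X collect the negative powers of v in the slice, in z0^m and in
    the denominator of y. *)
Lemma slice_divisible (x b : int) (m : nat) y p : (forall k, k \in msupp p -> x <= k.1) ->
  unit_at1 v y -> weighted_sum (slice_at v b) p = z ^ m%:Z * y ->
  exists (a c : nat) (r : {poly int}), r.[1] = 1 /\
  int_eval v ((\sum_(k <- msupp p | k.2 == b) (p@_k)%:P * 'X ^+ `|k.1 - x|) * 'X ^+ a) =
  int_eval v ((1 - 'X ^+ 2) ^+ m * (r * 'X ^+ c)).
Proof.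
move=> hx [N [r [r1 hr]]]; rewrite (slice_cleared b hx).
move: (\sum_(k <- _ | _) _) => Q hQ.
have [x1 [x2 def_x]] : exists x1 x2 : nat, x = x1%:Z - x2%:Z.
  by exists `|Num.max x 0|%N, `|Num.max (- x) 0|%N; lia.
exists (x1 + N + m)%N, x2, r; split=> //.
have hm : int_eval v ((1 - 'X ^+ 2) ^+ m) = (v * z) ^+ m.
  by have := int_eval_binom 0 m; rewrite /cleared_monomial expr0 !mul1r.
rewrite !int_evalM !int_evalXn hm exprMn -hr !exprD.
have hv : v ^+ x1 = v ^ x * v ^+ x2.
  by rewrite !exprnP -expfzDr //; congr (_ ^ _); lia.
rewrite hv.
have -> : int_eval v Q * (v ^ x * v ^+ x2 * v ^+ N * v ^+ m) =
   (v ^ x * int_eval v Q) * (v ^+ x2 * v ^+ N * v ^+ m) by move: (v ^ x) => *; ring.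
by rewrite hQ -[z ^ m]/(z ^+ m); ring.
Qed.
End Denominators.

(** A transcendental value of v, at which equal values come from equal polynomials. *)
Definition vfrac : {fraction {poly int}} := tofrac 'X.

Lemma int_eval_vfrac r : int_eval vfrac r = tofrac r.
Proof.
elim/poly_ind: r => [|r c IH]; first by rewrite /int_eval rmorph0 horner0 rmorph0.
rewrite /int_eval rmorphD rmorphM /= map_polyX map_polyC hornerMXaddC.
rewrite -/(int_eval vfrac r) IH rmorphD rmorphM; congr (_ + _).
by rewrite -{2}[c]intz rmorph_int rmorph_int.
Qed.

Lemma int_eval_inj : injective (int_eval vfrac).
Proof. by move=> r s; rewrite !int_eval_vfrac => /eqP; rewrite tofrac_eq => /eqP. Qed.

Lemma vfrac_neq0 : vfrac != 0.
Proof. by rewrite tofrac_eq0 polyX_eq0. Qed.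

Lemma vfrac_z_neq0 : vfrac^-1 - vfrac != 0.
Proof.
have : tofrac (1 - 'X ^+ 2 : {poly int}) != 0 by rewrite tofrac_eq0 sub1X2_neq0.
apply: contraNneq => h; rewrite rmorphB rmorph1 rmorphXn /= -/vfrac.
by rewrite -(mulfV vfrac_neq0) expr2 -mulrBr h mulr0.
Qed.

(** * Extremal terms of the polynomial *)

(** As X does not divide 1 - X^2, the powers of X divide the cofactor. *)
Lemma strip_powers_of_X (Q r : {poly int}) c m :
  Q * 'X ^+ c = (1 - 'X ^+ 2) ^+ m * r -> exists r', Q = (1 - 'X ^+ 2) ^+ m * r'.
Proof.
elim: c r => [|c IH] r h; first by exists r; rewrite -h expr0 mulr1.
have : root r 0.
  have := congr1 (horner^~ 0) h; rewrite exprSr !hornerM hornerX !mulr0.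
  by rewrite horner_exp !hornerE /= ?mulr0 ?subr0 expr1n mul1r => /esym/eqP.
move=> /factor_theorem [q def_r]; apply: (IH q).
apply: (mulIf (negbT (polyX_eq0 int))).
by rewrite -mulrA -exprSr h def_r polyC0 subr0 mulrA.
Qed.

Lemma leq_size_multiple (r : {poly int}) m : (1 - 'X ^+ 2) ^+ m * r != 0 ->
  (m.*2 < size ((1 - 'X ^+ 2) ^+ m * r)%R)%N.
Proof.
move=> h; have [h1 h2] : (1 - 'X ^+ 2) ^+ m != 0 :> {poly int} /\ r != 0.
  by apply/andP; rewrite -negb_or -mulf_eq0.
have := size_cleared_monomial 0 m; rewrite /cleared_monomial expr0 mul1r => hs.
rewrite size_mul // hs add0n addSn /= -[X in (X < _)%N]addn0 ltn_add2l.
by rewrite size_poly_gt0.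
Qed.

(** The coefficient of z^(-m) in p is, up to a power of v, a nonzero polynomial
    divisible by (1 - v^2)^m, hence of degree at least 2m. *)
Lemma slice_span n w (m : nat) p (x d : int) :
  skein_shape vfrac n w (m%:Z + 1) p ->
  (forall k : int * int, k \in msupp p -> x <= k.1 <= d) ->
  (exists2 k : int * int, k \in msupp p & k.2 = - m%:Z) /\ 2 * m%:Z <= d - x.
Proof.
move=> hp hx.
have hx0 (k : int * int) : k \in msupp p -> x <= k.1 by move=> /hx /andP [].
have [y [hy]] := shape_slice hp.
have -> : 1 - (m%:Z + 1) = - m%:Z by ring.
rewrite addrK => hQ.
have [a [c [r [r1]]]] := slice_divisible vfrac_neq0 vfrac_z_neq0 hx0 hy hQ.
move=> /int_eval_inj.
have hs : (size (\sum_(k <- msupp p | k.2 == - m%:Z) (p@_k)%:P * 'X ^+ `|k.1 - x|)%R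
    <= `|d - x|.+1)%N.
  apply: leq_trans (size_sum _ _ _) _; apply/bigmax_leqP_seq => -[k1 k2] /hx /= hk _.
  rewrite mul_polyC; apply: leq_trans (size_scale_leq _ _) _.
  by rewrite size_polyXn; lia.
have hex : (exists2 k : int * int, k \in msupp p & k.2 = - m%:Z) \/
   \sum_(k <- msupp p | k.2 == - m%:Z) (p@_k)%:P * 'X ^+ `|k.1 - x| = 0.
  case: (boolP (has (fun k : int * int => k.2 == - m%:Z) (msupp p))) => [|/hasPn hn].
    by case/hasP=> k hk /eqP hk2; left; exists k.
  by right; rewrite big_seq_cond big1 // => k /andP [/hn /negbTE ->].
move: (\sum_(k <- _ | _) _) hs hex => Q hs hex hQX.
have nz : (1 - 'X ^+ 2) ^+ m * (r * 'X^c) != 0.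
  rewrite !mulf_neq0 ?expf_neq0 ?sub1X2_neq0 ?polyX_eq0 //.
  by apply: contra_eq_neq r1 => ->; rewrite horner0 eq_sym oner_eq0.
have [r' def_Q] := strip_powers_of_X hQX.
have Q_neq0 : Q != 0 by apply: contraNneq nz => Q0; rewrite -hQX Q0 mul0r.
case: hex => [hex|Q0]; last by rewrite Q0 eqxx in Q_neq0.
split=> //; have [k /hx hk _] := hex.
have := leq_trans (leq_size_multiple (m := m) (r := r') _) _.
move/(_ `|d - x|.+1); rewrite -def_Q => /(_ Q_neq0 hs).
by lia.
Qed.

Lemma sign_parity a b : odd a = odd b -> (-1) ^+ a = (-1) ^+ b :> int.
Proof. by move=> h; rewrite -signr_odd h signr_odd. Qed.

(** After the substitution of z0 for z, a term with exponents (a, b) has degree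
    a + b in v and leading coefficient (-1)^b times its own.  The term (d, t) is
    alone in the top degree d + t, which must be the degree 0 of the constant 1. *)
Lemma top_term p (d t : int) :
  weighted_sum (eval_at vfrac) p = 1 -> (d, t) \in msupp p ->
  (forall k : int * int, k \in msupp p -> k.1 <= d /\ k.2 <= t) ->
  d + t = 0 /\ p@_(d, t) = (-1) ^+ `|t|.
Proof.
move=> hp htop hmax.
have bounded (f : int * int -> nat) : exists B : nat,
    forall k : int * int, k \in msupp p -> (f k <= B)%N.
  exists (\max_(k <- msupp p) f k)%N => k hk.
  exact: (@leq_bigmax_seq (int * int)%type _ xpredT f k hk isT).
have [B hB] := bounded (fun k => `|k.2|%N).
have [C hC] := bounded (fun k => `|k.1|%N).
pose A := (C + 2 * B)%N.
have hb (k : int * int) : k \in msupp p -> `|k.2| <= B%:Z /\ `|k.1| + 2 * B%:Z <= A%:Z.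
  by move=> hk; move: (hB k hk) (hC k hk); rewrite /A; lia.
have hAB : (2 * B <= A)%N by rewrite /A leq_addl.
have := int_eval_inj (eval_cleared vfrac_neq0 vfrac_z_neq0 hAB hb hp).
move: A hAB hb => A hAB hb.
(* The degree in v of the cleared term with exponents k. *)
pose deg (k : int * int) := (`|(k.1 - k.2 - B%:Z + A%:Z)%R| + `|(k.2 + B%:Z)%R|.*2)%N.
have hdeg (k : int * int) : k \in msupp p -> (deg k)%:Z = k.1 + k.2 + B%:Z + A%:Z.
  by move=> /hb [h1 h2]; rewrite /deg; lia.
move=> E; have coefE D : (forall k, k \in msupp p -> (deg k <= D)%N) ->
    \sum_(k <- msupp p | deg k == D) p@_k * (-1) ^+ `|k.2 + B%:Z| =
    (cleared_monomial (A - B) B)`_D.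
  move=> hD; rewrite -E coef_sum [LHS]big_mkcond !big_seq; apply: eq_bigr => k /hD hk.
  rewrite coefCM; case: eqP => [<-|/eqP ne]; first by rewrite coef_cleared_monomial.
  by rewrite nth_default ?mulr0 // size_cleared_monomial -/(deg k); lia.
have htb := hdeg _ htop.
have /= htb2 := hb _ htop.
have hDtop k : k \in msupp p -> (deg k <= deg (d, t))%N.
  by move=> hk; have := hdeg _ hk; have := hmax _ hk; rewrite /= in htb; lia.
(* A term of the degree of (d, t) has both exponents maximal, so that it is (d, t). *)
have ctop : \sum_(k <- msupp p | deg k == deg (d, t)) p@_k * (-1) ^+ `|k.2 + B%:Z| =
    p@_(d, t) * (-1) ^+ `|t + B%:Z|.
  rewrite big_mkcond (bigD1_seq (d, t)) ?fset_uniq //= eqxx big_seq_cond big1 ?addr0 //.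
  move=> k /andP [hk ne]; case: eqP => // h1; case/eqP: ne.
  have := hdeg _ hk; have := hmax _ hk; rewrite h1 htb; case: k {hk h1} => k1 k2 /=.
  by move=> [h1 h2] h3; congr pair; lia.
have lead_neq0 : (cleared_monomial (A - B) B)`_(deg (d, t)) != 0.
  rewrite -coefE // ctop mulf_neq0 ?signr_eq0 //.
  by rewrite mcoeff_neq0.
have le1 : (deg (d, t) <= A - B + B.*2)%N.
  rewrite leqNgt; apply: contra lead_neq0 => h.
  by rewrite nth_default // size_cleared_monomial.
have le2 : (A - B + B.*2 <= deg (d, t))%N.
  rewrite leqNgt; apply/negP => h.
  have := coefE (A - B + B.*2)%N; rewrite coef_cleared_monomial big_seq_cond big1.
    move=> /(_ (fun k hk => leq_trans (hDtop k hk) (ltnW h))) /esym /eqP.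
    by rewrite signr_eq0.
  by move=> k /andP [/hDtop hk /eqP hk']; lia.
(* The right side has degree A + B, written with truncated subtraction. *)
have eD : deg (d, t) = (A - B + B.*2)%N by apply/eqP; rewrite eqn_leq le1 le2.
split; first by rewrite /= in htb; lia.
have := coefE _ hDtop; rewrite ctop eD coef_cleared_monomial => h.
have -> : p@_(d, t) = (-1) ^+ B * (-1) ^+ `|t + B%:Z|.
  by rewrite -h -mulrA -expr2 sqrr_sign mulr1.
rewrite -exprD; apply: sign_parity.
by lia.
Qed.

(** * Degrees and conclusion *)

Lemma seq_max_ub s k : k \in s -> k <= seq_max s.
Proof.
rewrite /seq_max; move: (head 0 s) => x0; elim: s => // y s IH.
rewrite inE big_cons le_max => /orP [/eqP ->|/IH ->]; rewrite ?lexx ?orbT //.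
Qed.

Lemma seq_min_lb s k : k \in s -> seq_min s <= k.
Proof.
rewrite /seq_min; move: (head 0 s) => x0; elim: s => // y s IH.
rewrite inE big_cons ge_min => /orP [/eqP ->|/IH ->]; rewrite ?lexx ?orbT //.
Qed.

Lemma seq_max_mem s k : k \in s -> seq_max s \in s.
Proof.
move=> hs; rewrite /seq_max; have h x0 : \big[Num.max/x0]_(k <- s) k \in x0 :: s.
  elim: (s) => [|y s' IH]; first by rewrite big_nil inE.
  rewrite big_cons; case: leP => _; last by rewrite !inE eqxx orbT.
  by move: IH; rewrite !inE => /orP [->|->]; rewrite ?orbT.
have := h (head 0 s); rewrite inE => /orP [/eqP ->|//].
by case: (s) hs => // y s' _; rewrite /= inE eqxx.
Qed.

Lemma coef_coef_v a b p : (coef_v a p)@_b = p@_(a, b).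
Proof.
rewrite /coef_v raddf_sum [in RHS](monalgE p) raddf_sum big_mkcond.
apply: eq_bigr => -[x y] _ /=; rewrite !mcoeffU xpair_eqE.
by case: eqP.
Qed.

Lemma malg_neq0P (q : laurent_z) : reflect (exists b, q@_b != 0) (q != 0).
Proof.
apply: (iffP idP) => [|[b]]; last by apply: contraNneq => ->; rewrite mcoeff0.
case E : (enum_fset (msupp q)) => [|b s] => [/eqP []|_].
  by rewrite [q]monalgE E big_nil.
by exists b; rewrite mcoeff_neq0 -[_ \in _]/(b \in enum_fset (msupp q)) E inE eqxx.
Qed.

Lemma intsignE (e : int) : (-1 : int) ^ e = (-1) ^+ `|e|.
Proof. by case: e => n //; rewrite NegzE -exprnN invr_sign. Qed.

Lemma braid_closureE n (beta : braid n) :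
  braid_closure beta = word_closure n [seq (val x.1, x.2) | x <- beta].
Proof. by rewrite /braid_closure /word_closure /crossings -map_comp. Qed.

Lemma is_word_braid n (beta : braid n.+1) :
  is_word n.+1 [seq (val x.1, x.2) | x <- beta].
Proof. by rewrite /is_word all_map; apply/allP => -[i e] _ /=; rewrite ltnS ltn_ord. Qed.

Theorem corollary2p6 (P : diagram -> laurent_vz) (hP : is_homflypt P)
    (n : nat) (beta : braid n) (m M : 'I_n)
    (hm : is_first_proper (mfw P beta) m)
    (hM : is_last_proper (mfw P beta) M)
    (hdeg : degz (mfw P beta M) = deg_z (P (braid_closure beta))) :
  [/\ deg_z (P (braid_closure beta)) = - deg_v (P (braid_closure beta)),
      monicz ((-1) ^ (writhe beta - n%:Z + 1) *: mfw P beta M)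
    & mindeg_v (P (braid_closure beta)) <=
        Num.min ((ncomponents (braid_closure beta))%:Z - 1 - 2 * (M%:Z - m%:Z))
                (1 - (ncomponents (braid_closure beta))%:Z)].
Proof.
case: n => [|N] in beta m M hm hM hdeg *; first by case: (M).
have hw := is_word_braid beta.
have def_w : writhe beta = word_writhe [seq (val x.1, x.2) | x <- beta].
  by rewrite /writhe /word_writhe big_map.
have hshape := closure_shapeP hP vfrac_neq0 vfrac_z_neq0 (leqnn N.+1) hw.
rewrite /closure_shape /cycles -def_w -ncomponents_closure // in hshape.
rewrite -braid_closureE addrK in hshape.
have [mu def_mu] : exists mu : nat, ncomponents (braid_closure beta) = mu.+1.
  rewrite braid_closureE ncomponents_closure //.
  set S := porbits _; have : (0 < #|S|)%N.
    apply/card_gt0P.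
    exists (porbit (word_perm N [seq (val x.1, x.2) | x <- beta]) ord0).
    exact: imset_f.
  by case: #|S| => // k _; exists k.
rewrite def_mu in hshape *.
have mfwE j b : (mfw P beta j)@_b =
    (P (braid_closure beta))@_(writhe beta - N.+1%:Z + 1 + (2 * j)%:Z, b).
  by rewrite coef_coef_v.
move: (P (braid_closure beta)) hshape mfwE hdeg {def_mu hw def_w} => p hp hE hdeg.
move: (mfw P beta) (writhe beta) hm hM hp hE hdeg => h w [hm _] [hM hlast] hp hE hdeg.
have in_v (k : int * int) : k \in msupp p -> k.1 \in [seq k.1 | k <- msupp p].
  by move=> hk; apply: (map_f fst).
have in_z (k : int * int) : k \in msupp p -> k.2 \in [seq k.2 | k <- msupp p].
  by move=> hk; apply: (map_f snd).
have [bM hbM] := malg_neq0P _ hM.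
have [bm hbm] := malg_neq0P _ hm.
have hMp : (w - N.+1%:Z + 1 + (2 * M)%:Z, bM) \in msupp p by rewrite -mcoeff_neq0 -hE.
have hmp : (w - N.+1%:Z + 1 + (2 * m)%:Z, bm) \in msupp p by rewrite -mcoeff_neq0 -hE.
have max_v (k : int * int) : k \in msupp p -> k.1 <= deg_v p.
  by move=> hk; apply/seq_max_ub/in_v.
have max_z (k : int * int) : k \in msupp p -> k.2 <= deg_z p.
  by move=> hk; apply/seq_max_ub/in_z.
have min_v (k : int * int) : k \in msupp p -> mindeg_v p <= k.1.
  by move=> hk; apply/seq_min_lb/in_v.
(* The top exponent d of v is w - n + 1 + 2j' with j' = n - 1 - j; it is at least
   that of h_M, so that j' >= 0, and j' <= M since M is the last index. *)
have def_d : deg_v p = w - N.+1%:Z + 1 + (2 * M)%:Z.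
  have : deg_v p \in [seq k.1 | k <- msupp p].
    exact: seq_max_mem (in_v _ hMp).
  case/mapP=> -[d b] hdb /= def_d.
  have /= dM := max_v _ hMp.
  have [j /= hj] := shape_v hp hdb.
  have hjN : (N - j < N.+1)%N by lia.
  have : h (Ordinal hjN) != 0.
    apply/malg_neq0P; exists b; rewrite hE mcoeff_neq0 /=.
    by rewrite (_ : w - N.+1%:Z + 1 + (2 * (N - j))%:Z = d) //; lia.
  by move/hlast => /=; lia.
have htop : (deg_v p, deg_z p) \in msupp p.
  rewrite -mcoeff_neq0 def_d -hE -hdeg mcoeff_neq0.
  by apply: (@seq_max_mem _ bM); rewrite mcoeff_neq0 in hbM.
have hmax (k : int * int) : k \in msupp p -> k.1 <= deg_v p /\ k.2 <= deg_z p.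
  by move=> hk; split; [apply: max_v | apply: max_z].
have [hsum hlead] := top_term (shape_eval hp) htop hmax.
have hzd : deg_z p = - deg_v p by lia.
rewrite (_ : mu.+1%:Z = mu%:Z + 1) in hp; last lia.
have hrange (k : int * int) : k \in msupp p -> mindeg_v p <= k.1 <= deg_v p.
  by move=> hk; rewrite min_v // max_v.
have [[k0 hk0 hk0z] hspan] := slice_span hp hrange.
have := max_z _ hk0; rewrite hk0z => hz.
have /= hxm := min_v _ hmp.
split=> //; last by rewrite le_min; apply/andP; split; lia.
have e_neq0 : (-1 : int) ^ (w - N.+1%:Z + 1) != 0 by rewrite intsignE signr_eq0.
rewrite /monicz /degz msuppZ (negbTE e_neq0) -/(degz (h M)) hdeg.
rewrite mcoeffZ hE -def_d hlead intsignE -exprD; apply/eqP.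
by rewrite -[RHS](expr0 (-1)); apply: sign_parity; lia.
Qed.
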